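(* Let $L$ be an algebraically closed field with $\operatorname{char} L=0$, and let $p_{1},p_{2}\in L[x,y]$ be irreducible polynomials with $p_{1}(0,0)=p_{2}(0,0)=0$ and without common factor. Then the intersection multiplicity of $p_{1},p_{2}$ at $(0,0)$ equals the Zariski multiplicity at $(0,0,0,0)$ of the cover $Spec(L[x,y,u,v]/\langle p_{1}-u,p_{2}-v\rangle)\to Spec(L[u,v])$.
   Context: Specialisation. Put $K_{0}=L$ and inductively let $K_{i+1}=K_{i}((t_{i+1}))^{alg}$; put $K_{\omega}=\bigcup_{i}K_{i}$. The $t_{i+1}$-adic valuation extends uniquely to $K_{i+1}$, with residue field $K_i$. Define $\pi_{i+1}:P^{n}(K_{i+1})\to P^{n}(K_{i})$ by rescaling homogeneous coordinates so that all have valuation $\geq 0$ and at least one has valuation $0$, and then taking residues; $\Pi_{\omega}:P^{n}(K_{\omega})\to P^{n}(L)$ is $\pi_{1}\circ\cdots\circ\pi_{N}$ on $P^{n}(K_{N})$. For a point $a\in A^n(L)\subset P^n(L)$, its infinitesimal neighbourhood is ${\mathcal V}_{a}=\Pi_{\omega}^{-1}(a)\subset A^n(K_\omega)$. A point $\bar\epsilon\in A^n(K_\omega)$ is generic over $L$ if its coordinates are algebraically independent over $L$. Zariski multiplicity of the given cover at $(0,0,0,0)$: the number of points $(x,y)\in{\mathcal V}_{(0,0)}$ with $p_{1}(x,y)=\epsilon_{1}$ and $p_{2}(x,y)=\epsilon_{2}$, where $(\epsilon_{1},\epsilon_{2})\in{\mathcal V}_{(0,0)}$ is generic over $L$ (the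 number does not depend on the choice of $(\epsilon_1,\epsilon_2)$). Intersection multiplicity: $I(p_1,p_2,(0,0))=length\big(L[x,y]_{(0,0)}/\langle p_{1},p_{2}\rangle\big)$, where $L[x,y]_{(0,0)}$ is the local ring of $A^2$ at the origin. *)

(* Defs.v *)
From HB Require Import structures.
From mathcomp Require Import all_boot all_order all_algebra.
From mathcomp Require Import boolp.
From mathcomp Require Import mpoly.

Set Implicit Arguments.
Unset Strict Implicit.
Unset Printing Implicit Defensive.

Import GRing.Theory.
Local Open Scope ring_scope.

Local Notation "x %:F" := (@FracField.tofrac _ x).

(* f n is the coefficient of t^n; k((t)) below is the fraction field. *)
Definition fps (R : Type) := nat -> R.

Definition fps_trunc (R : comNzRingType) N (f : fps R) : {poly R} :=
  \poly_(i < N.+1) f i.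

Section FpsRing.
Variable R : comNzRingType.
Implicit Types f g h : fps R.

HB.instance Definition _ := Choice.copy (fps R) (nat -> R).

Definition fps_const (c : R) : fps R := fun n => if n is 0 then c else 0.
Definition fps_opp f : fps R := fun n => - f n.
Definition fps_add f g : fps R := fun n => f n + g n.
Definition fps_mul f g : fps R := fun n => \sum_(i < n.+1) f i * g (n - i)%N.

Fact fps_addA : associative fps_add.
Proof. by move=> f g h; apply/funext=> n; apply: addrA. Qed.
Fact fps_addC : commutative fps_add.
Proof. by move=> f g; apply/funext=> n; apply: addrC. Qed.
Fact fps_add0 : left_id (fps_const 0) fps_add.
Proof. by move=> f; apply/funext=> -[|n]; apply: add0r. Qed.
Fact fps_addN : left_inverse (fps_const 0) fps_opp fps_add.
Proof. by move=> f; apply/funext=> -[|n]; apply: addNr. Qed.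

HB.instance Definition _ :=
  GRing.isZmodule.Build (fps R) fps_addA fps_addC fps_add0 fps_addN.

Lemma fps_mul_trunc N n f g (le_nN : (n <= N)%N) :
  fps_mul f g n = (fps_trunc N f * fps_trunc N g)`_n.
Proof.
rewrite coefM; apply: eq_bigr => i _; rewrite !coef_poly.
by rewrite !ltnS (leq_trans (leq_ord i) le_nN) (leq_trans (leq_subr _ _) le_nN).
Qed.

Fact fps_mulC : commutative fps_mul.
Proof.
by move=> f g; apply/funext=> n; rewrite !(fps_mul_trunc _ _ (leqnn n)) mulrC.
Qed.

Fact fps_mulA : associative fps_mul.
Proof.
move=> f g h; apply/funext=> n.
pose F := fps_trunc n f; pose G := fps_trunc n g; pose H := fps_trunc n h.
transitivity ((F * (G * H))`_n).
  rewrite (fps_mul_trunc _ _ (leqnn n)) !coefM; apply: eq_bigr => i _.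
  by rewrite -(fps_mul_trunc _ _ (leq_subr i n)) [X in _ * X]coef_poly
             ltnS leq_subr.
rewrite mulrA (fps_mul_trunc _ _ (leqnn n)) !coefM; apply: eq_bigr => i _.
by rewrite -(fps_mul_trunc _ _ (leq_ord i)) [in RHS]coef_poly ltn_ord.
Qed.

Fact fps_mul1 : left_id (fps_const 1) fps_mul.
Proof.
move=> f; apply/funext=> n; rewrite /fps_mul big_ord_recl subn0 mul1r.
by rewrite big1 ?addr0 // => i _; rewrite mul0r.
Qed.

Fact fps_mulD : left_distributive fps_mul fps_add.
Proof.
move=> f g h; apply/funext=> n; rewrite /fps_mul /fps_add -big_split /=.
by apply: eq_bigr => i _; rewrite mulrDl.
Qed.

Fact fps_1neq0 : fps_const 1 != fps_const 0.
Proof. by apply/eqP => /(congr1 (@^~ 0%N)) /eqP; rewrite oner_eq0. Qed.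

HB.instance Definition _ := GRing.Zmodule_isComNzRing.Build (fps R)
  fps_mulA fps_mulC fps_mul1 fps_mulD fps_1neq0.

Definition fps_unit : pred (fps R) := fun f => `[< exists g, g * f = 1 >].
Definition fps_inv f : fps R :=
  if pselect (exists g, g * f = 1) is left H then sval (cid H) else f.

Fact fps_mulV : {in fps_unit, left_inverse 1 fps_inv *%R}.
Proof. by move=> f /asboolP Uf; rewrite /fps_inv; case: pselect => // H; case: cid. Qed.
Fact fps_unitP f g : g * f = 1 -> fps_unit f.
Proof. by move=> fg1; apply/asboolP; exists g. Qed.
Fact fps_inv_out : {in [predC fps_unit], fps_inv =1 id}.
Proof. by move=> f /asboolP nUf; rewrite /fps_inv; case: pselect. Qed.

HB.instance Definition _ := GRing.ComNzRing_hasMulInverse.Build (fps R)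
  fps_mulV fps_unitP fps_inv_out.

Fact fps_const_zmod_morphism : zmod_morphism fps_const.
Proof.
move=> a b; apply/funext=> -[|n] //.
by change (0 = 0 - 0 :> R); rewrite subr0.
Qed.
Fact fps_const_monoid_morphism : monoid_morphism fps_const.
Proof.
split=> // a b; apply/funext=> n; rewrite [RHS]/(fps_mul _ _ _) /fps_mul.
rewrite big_ord_recl subn0 big1 ?addr0 => [|i _]; last by rewrite mul0r.
by case: n => [|n] //=; rewrite mulr0.
Qed.
HB.instance Definition _ :=
  GRing.isZmodMorphism.Build R (fps R) fps_const fps_const_zmod_morphism.
HB.instance Definition _ :=
  GRing.isMonoidMorphism.Build R (fps R) fps_const fps_const_monoid_morphism.

(* 0 for the zero series *)
Definition fps_order f : nat :=
  if pselect (exists n, f n != 0) is left H then ex_minn H else 0.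

Lemma fps_orderP f : f != 0 ->
  f (fps_order f) != 0 /\ (forall i, (i < fps_order f)%N -> f i = 0).
Proof.
move=> nz; rewrite /fps_order; case: pselect => [H | nH].
  case: ex_minnP => m fm m_min; split=> // i lt_im.
  by apply/eqP; apply: contraLR lt_im; rewrite -leqNgt; apply: m_min.
case/eqP: nz; apply/funext=> n; apply/eqP; apply/negPn/negP => fn.
by apply: nH; exists n; case: n fn.
Qed.

End FpsRing.

Section FpsDomain.
Variable R : idomainType.

Fact fps_idomain_axiom (f g : fps R) : f * g = 0 -> (f == 0) || (g == 0).
Proof.
move=> fg0; apply/norP => -[/fps_orderP[fm f_lt] /fps_orderP[gn g_lt]].
move: fm gn f_lt g_lt; set m := fps_order f; set n := fps_order g.
move=> fm gn f_lt g_lt; have /eqP[] : f m * g n != 0 by rewrite mulf_neq0.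
have lt_m : (m < (m + n).+1)%N by rewrite ltnS leq_addr.
transitivity ((f * g) (m + n)%N); last by rewrite fg0; case: (m + n)%N.
rewrite [RHS]/(fps_mul _ _ _) /fps_mul (bigD1 (Ordinal lt_m)) //= addKn.
rewrite big1 ?addr0 // => i; rewrite -val_eqE /= neq_ltn => /orP[lt_im|lt_mi].
  by rewrite f_lt ?mul0r.
by rewrite g_lt ?mulr0 // ltn_subLR ?ltn_add2r // -ltnS.
Qed.

HB.instance Definition _ :=
  GRing.ComUnitRing_isIntegral.Build (fps R) fps_idomain_axiom.

End FpsDomain.

Definition laurent (k : fieldType) : fieldType := {fraction fps k}.

(* junk at x = 0 *)
Definition tadic (k : fieldType) (x : laurent k) : rat :=
  (fps_order (\n_(repr x)))%:R - (fps_order (\d_(repr x)))%:R.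

(* Only the values v x with x != 0 are meaningful: the convention v 0 = +oo is
   built into [val_ge0], [val_gt0] and [val_eq0]. *)
Definition valuation (F : fieldType) (v : F -> rat) : Prop :=
  (forall x y, x != 0 -> y != 0 -> v (x * y) = v x + v y) /\
  (forall x y, x != 0 -> y != 0 -> x + y != 0 ->
    Order.min (v x) (v y) <= v (x + y)).

Definition val_ge0 (F : fieldType) (v : F -> rat) x := (x == 0) || (0 <= v x).
Definition val_gt0 (F : fieldType) (v : F -> rat) x := (x == 0) || (0 < v x).
Definition val_eq0 (F : fieldType) (v : F -> rat) x := (x != 0) && (v x == 0).

(* An algebraic closure of k((t)) together with the extension of the t-adic
   valuation, normalised by v(t) = 1, so that its value group is the group of
   rational numbers. *)
Record laurent_closure (k : closedFieldType) := LaurentClosure {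
  lc_field :> closedFieldType;
  lc_embed : {rmorphism laurent k -> lc_field};
  lc_algebraic : forall x, algebraicOver lc_embed x;
  lc_val : lc_field -> rat;
  lc_valuation : valuation lc_val;
  lc_val_embed : forall x, x != 0 -> lc_val (lc_embed x) = tadic x
}.

Definition lc_const (k : closedFieldType) (E : laurent_closure k) : k -> E :=
  fun c => lc_embed E (fps_const c)%:F.

(* k maps isomorphically onto the residue field, so the residue of an x with
   v(x) >= 0 is the unique c in k congruent to x modulo the maximal ideal. *)
Definition has_residue (k : closedFieldType) (E : laurent_closure k)
  (x : E) (c : k) : Prop := val_gt0 (@lc_val k E) (x - lc_const E c).

(* Points of P^n are given by homogeneous coordinates: this is the graph of
   P^n(E) -> P^n(k), stable under rescaling of x (absorbed by c) and of y
   (rescale c by a nonzero constant of k). *)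
Definition specialises (k : closedFieldType) (E : laurent_closure k) n
    (x : 'rV[E]_n.+1) (y : 'rV[k]_n.+1) : Prop :=
  exists c : E, [/\ c != 0,
    forall j, val_ge0 (@lc_val k E) (c * x 0 j),
    exists j, val_eq0 (@lc_val k E) (c * x 0 j) &
    forall j, has_residue (c * x 0 j) (y 0 j)].

Section Tower.
Variable closure : forall k : closedFieldType, laurent_closure k.
Variable L : closedFieldType.

Fixpoint tower (i : nat) : closedFieldType :=
  if i is i'.+1 then closure (tower i') else L.

Definition tower_incl (i : nat) : tower i -> tower i.+1 :=
  @lc_const (tower i) (closure (tower i)).

(* The increasing union of the tower, up to unique isomorphism. *)
Record tower_union := TowerUnion {
  tu_field :> fieldType;
  tu_in : forall i, {rmorphism tower i -> tu_field};
  tu_compat : forall i (x : tower i), tu_in i.+1 (tower_incl x) = tu_in i x;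
  tu_exhaust : forall z : tu_field, exists i (x : tower i), z = tu_in i x
}.

Fixpoint Pi_tower n (N : nat) : 'rV[tower N]_n.+1 -> 'rV[L]_n.+1 -> Prop :=
  match N return 'rV[tower N]_n.+1 -> 'rV[L]_n.+1 -> Prop with
  | 0 => fun x a => exists2 c : L, c != 0 & a = c *: x
  | N'.+1 => fun x a => exists2 y : 'rV[tower N']_n.+1,
      @specialises (tower N') (closure (tower N')) n x y & Pi_tower y a
  end.

Variable K : tower_union.

(* Every point of P^n(K) has homogeneous coordinates in some [tower N]; the
   image does not depend on N, as constants are their own residues. *)
Definition Pi_omega n (x : 'rV[K]_n.+1) (a : 'rV[L]_n.+1) : Prop :=
  exists N (c : K) (y : 'rV[tower N]_n.+1),
    [/\ c != 0, c *: x = map_mx (tu_in K N) y & Pi_tower y a].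

Definition affine_to_proj (F : fieldType) n (x : 'rV[F]_n) : 'rV[F]_n.+1 :=
  row_mx (1%:M : 'M_1) x.

Definition inf_nbhd n (a : 'rV[L]_n) (x : 'rV[K]_n) : Prop :=
  Pi_omega (affine_to_proj x) (affine_to_proj a).

Definition base_incl : {rmorphism L -> K} := tu_in K 0.

Definition eval_in n (p : {mpoly L[n]}) (x : 'rV[K]_n) : K :=
  (map_mpoly base_incl p).@[x 0].

Definition generic n (x : 'rV[K]_n) : Prop :=
  forall p : {mpoly L[n]}, eval_in p x = 0 -> p = 0.

Definition has_card (T : eqType) (A : T -> Prop) (m : nat) : Prop :=
  exists s : seq T, [/\ uniq s, size s = m & forall z, z \in s <-> A z].

Definition zariski_multiplicity (p1 p2 : {mpoly L[2]}) (m : nat) : Prop :=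
  forall eps : 'rV[K]_2, generic eps -> inf_nbhd 0 eps ->
    has_card (fun z : 'rV[K]_2 =>
      [/\ inf_nbhd 0 z, eval_in p1 z = eps 0 0 & eval_in p2 z = eps 0 1]) m.

End Tower.

Section LocalRing.
Variables (L : fieldType) (n : nat) (a : 'rV[L]_n).

Definition regular_at : {pred {fraction {mpoly L[n]}}} :=
  fun f => `[< exists p q : {mpoly L[n]}, q.@[a 0] != 0 /\ f = p%:F / q%:F >].

Lemma regular_den (q : {mpoly L[n]}) : q.@[a 0] != 0 -> q%:F != 0.
Proof. by rewrite tofrac_eq0; apply: contraNneq => ->; rewrite meval0. Qed.

Fact regular_at_subring : subring_closed regular_at.
Proof.
split.
- by apply/asboolP; exists 1, 1; rewrite meval1 oner_eq0 tofrac1 divr1.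
- move=> _ _ /asboolP[p [q [qa ->]]] /asboolP[p' [q' [q'a ->]]].
  apply/asboolP; exists (p * q' - p' * q), (q * q').
  rewrite mevalM mulf_neq0 //; split=> //.
  rewrite -[- (_ / _)]mulNr addf_div ?regular_den //.
  by rewrite tofracB !tofracM mulNr.
- move=> _ _ /asboolP[p [q [qa ->]]] /asboolP[p' [q' [q'a ->]]].
  apply/asboolP; exists (p * p'), (q * q').
  by rewrite mevalM mulf_neq0 // !rmorphM /= mulf_div.
Qed.
HB.instance Definition _ :=
  GRing.isSubringClosed.Build _ regular_at regular_at_subring.

Record local_ring := LocalRing {
  lr_val :> {fraction {mpoly L[n]}};
  lr_valP : lr_val \in regular_at
}.
HB.instance Definition _ := [isSub for lr_val].
HB.instance Definition _ := [Choice of local_ring by <:].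
HB.instance Definition _ := [SubChoice_isSubComNzRing of local_ring by <:].

Fact tofrac_regular (p : {mpoly L[n]}) : p%:F \in regular_at.
Proof. by apply/asboolP; exists p, 1; rewrite meval1 oner_eq0 tofrac1 divr1. Qed.

Definition to_local (p : {mpoly L[n]}) : local_ring :=
  LocalRing (tofrac_regular p).

End LocalRing.

Section IdealQuotient.
Variables (R : comNzRingType) (f g : R).

Definition ideal2 : {pred R} := fun z => `[< exists a b, z = a * f + b * g >].

Fact ideal2_zmod : zmod_closed ideal2.
Proof.
split; first by apply/asboolP; exists 0, 0; rewrite !mul0r addr0.
move=> _ _ /asboolP[a [b ->]] /asboolP[a' [b' ->]]; apply/asboolP.
by exists (a - a'), (b - b'); rewrite !mulrBl opprD addrACA.
Qed.
HB.instance Definition _ := GRing.isZmodClosed.Build R ideal2 ideal2_zmod.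

Fact ideal2M a x : x \in ideal2 -> a * x \in ideal2.
Proof.
move=> /asboolP[b [c ->]]; apply/asboolP; exists (a * b), (a * c).
by rewrite mulrDr !mulrA.
Qed.

Definition quot2 := Quotient.quot ideal2.
HB.instance Definition _ := GRing.Zmodule.on quot2.
HB.instance Definition _ := ZmodQuotient.on quot2.

Local Open Scope quotient_scope.

Definition quot2_scale (a : R) (x : quot2) : quot2 := \pi_quot2 (a * repr x).

Lemma quot2_scale_pi a x : quot2_scale a (\pi_quot2 x) = \pi_quot2 (a * x).
Proof.
apply/eqP; rewrite /quot2_scale -Quotient.idealrBE -mulrBr ideal2M //.
by rewrite Quotient.idealrBE reprK.
Qed.

Fact quot2_scaleA a b x :
  quot2_scale a (quot2_scale b x) = quot2_scale (a * b) x.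
Proof. by rewrite quot2_scale_pi mulrA. Qed.
Fact quot2_scale1 : left_id 1 quot2_scale.
Proof. by move=> x; rewrite /quot2_scale mul1r reprK. Qed.
Fact quot2_scaleDr : right_distributive quot2_scale +%R.
Proof.
move=> a x y; rewrite -[x]reprK -[y]reprK -(raddfD \pi_quot2).
by rewrite !quot2_scale_pi mulrDr raddfD.
Qed.
Fact quot2_scaleDl x : {morph quot2_scale^~ x : a b / a + b}.
Proof. by move=> a b; rewrite /quot2_scale mulrDl raddfD. Qed.
HB.instance Definition _ := GRing.Zmodule_isLmodule.Build R quot2
  quot2_scaleA quot2_scale1 quot2_scaleDr quot2_scaleDl.

End IdealQuotient.

Section Length.
Variables (R : pzRingType) (M : lmodType R).

Definition submodule (N : M -> Prop) : Prop :=
  N 0 /\ forall (a : R) x y, N x -> N y -> N (a *: x + y).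

Definition submodule_chain (m : nat) (N : 'I_m.+1 -> M -> Prop) : Prop :=
  (forall i, submodule (N i)) /\
  forall i j : 'I_m.+1, (i < j)%N ->
    (forall x, N i x -> N j x) /\ exists2 x, N j x & ~ N i x.

Definition has_length (m : nat) : Prop :=
  (exists N, @submodule_chain m N) /\
  forall m' N, @submodule_chain m' N -> (m' <= m)%N.

End Length.

Definition intersection_multiplicity (L : fieldType) (p1 p2 : {mpoly L[2]})
    (a : 'rV[L]_2) (m : nat) : Prop :=
  has_length (quot2 (to_local a p1) (to_local a p2)) m.

Definition irreducible (R : unitRingType) (p : R) : Prop :=
  [/\ p != 0, p \isn't a GRing.unit &
      forall a b, p = a * b -> a \is a GRing.unit \/ b \is a GRing.unit].

Definition no_common_factor (R : unitRingType) (p q : R) : Prop :=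
  forall d a b, p = d * a -> q = d * b -> d \is a GRing.unit.

(* Main.v *)
From HB Require Import structures.
Require Import Defs.
From mathcomp Require Import all_boot all_order all_algebra.
From mathcomp Require Import boolp.
From mathcomp Require Import mpoly.
From mathcomp Require Import zify ring lra.
Set Implicit Arguments.
Unset Strict Implicit.
Unset Printing Implicit Defensive.
Import GRing.Theory.
Local Open Scope ring_scope.
Local Notation "x %:F" := (@FracField.tofrac _ x).

(* After a generic shear x' = x + l y, y' = y, both polynomials have constant
   leading coefficient in y' and the origin is their only common zero on the
   line x' = 0.  Let R(u, v, x') be the resultant in y' of p1 - u and p2 - v.

   The Sylvester cokernel shows that the local ring at the origin modulo
   (p1, p2) has dimension, hence length, the multiplicity m of the root 0 of
   R(0, 0, x').  For a generic infinitesimal eps, the coefficients of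
   R(eps, x') have those of R(0, 0, x') as residues, so R(eps, x') has exactly
   m infinitesimal roots with multiplicity.  Since y' is integral over x',
   they are the abscissas of the infinitesimal solutions of p1 = eps1,
   p2 = eps2, and a shear that separates the solutions makes this bijective
   as soon as the roots are simple.

   A multiple root would force the Jacobian of (p1, p2) to vanish at a
   solution.  A tangent vector killed by it defines a point derivation that
   kills p1 and p2; in characteristic 0, at a point over a generic eps, such a
   derivation kills everything algebraic over L(p1, p2), in particular x + l y
   for two distinct l, so it is zero. *)

(** * Torsion of a cokernel over k[x] *)

(** The order of quantifiers shapes the argument: one [m] must serve every generic [eps], while a
    shear separating the solutions depends on [eps]. So [m] is read off a shear chosen before [eps],
    the points are counted with a second shear, and uniqueness of the length identifies the two
    numbers. Each requirement on a shear is ensured by the nonvanishing at [l] of a one-variable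
    polynomial, possibly over K; in characteristic 0 some value in L meets several of them at once.

    Length and resultant meet in the quotient of L[x', y'] by (P, Q), the cokernel over L[x'] of a
    matrix whose determinant is the resultant: its torsion at the root 0 has dimension [m], and it
    is the local quotient because only the origin lies over x' = 0. The same fact over K bounds the
    multiplicity at a nondegenerate zero by 1.

    The tower enters only through a residue relation from K to L that behaves as a place: it
    respects differences and products, and an element without a residue has an inverse of residue
    0. *)

Section TorsionBasis.
Variables (k : fieldType) (xi : k).
Local Notation X := ('X - xi%:P).

(* A kernel vector of [Phi] at [xi] gives a combination of its rows divisible by
   [X]; dividing that row by [X] divides the determinant by [X] and enlarges the
   row module by one dimension. *)
Lemma det_root_factor d (Phi : 'M[{poly k}]_d) : root (\det Phi) xi ->
  exists i0 (Delta Psi : 'M[{poly k}]_d),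
  [/\ Phi = Delta *m Psi, \det Delta = X,
      forall j, Delta j i0 = (j == i0)%:R * X &
      forall v : 'rV_d, exists (c : k) (u : 'rV_d),
        v = c%:P *: delta_mx 0 i0 + u *m Delta].
Proof.
move=> rt.
have: \det (map_mx (horner_eval xi) Phi) == 0.
  by rewrite det_map_mx /horner_eval; apply: rt.
case/det0P=> w0 w0nz w0P.
have [i0 w0i0] : exists i0, w0 0 i0 != 0.
  by apply/existsP; apply: contraNT w0nz; rewrite negb_exists => /forallP h;
     apply/eqP/rowP=> i; rewrite mxE; apply/eqP; move: (h i); rewrite negbK.
pose w := (w0 0 i0)^-1 *: w0.
have wi0 : w 0 i0 = 1 by rewrite mxE mulVf.
have wP : w *m map_mx (horner_eval xi) Phi = 0 by rewrite -scalemxAl w0P scaler0.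
clearbody w => {w0 w0nz w0P w0i0}.
pose g : 'rV[{poly k}]_d := \row_j ((\sum_i (w 0 i)%:P * Phi i j) %/ X).
have gP j : g 0 j * X = \sum_i (w 0 i)%:P * Phi i j.
  rewrite mxE divpK // dvdp_XsubCl /root horner_sum.
  move/rowP: wP => /(_ j); rewrite !mxE => wPj.
  apply/eqP; rewrite -[RHS]wPj; apply: eq_bigr => i _.
  by rewrite hornerM hornerC mxE.
pose Psi : 'M[{poly k}]_d := \matrix_(i, j) if i == i0 then g 0 j else Phi i j.
(* Row [i0] of [Delta] solves [X g = \sum_i w_i Phi_i] for the row of [Phi] at [i0], possible since
   [w 0 i0 = 1]; the other rows are those of the identity. *)
pose Delta : 'M[{poly k}]_d := \matrix_(i, j)
  if i == i0 then (if j == i0 then X else - (w 0 j)%:P) else (i == j)%:R.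
exists i0, Delta, Psi; have colD j : Delta j i0 = (j == i0)%:R * X.
  by rewrite !mxE; case: eqP => _; rewrite ?eqxx ?mul1r ?mul0r.
split => //.
- apply/matrixP=> i j; rewrite [RHS]mxE.
  have [->|nei] := eqVneq i i0.
    rewrite (bigD1 i0) //= [Delta i0 i0]mxE [Psi i0 j]mxE !eqxx mulrC gP (bigD1 i0) //= wi0 mul1r.
    rewrite -addrA -big_split big1 ?addr0 // => l nel.
    rewrite !mxE eqxx (negPf nel) mulNr; apply: subrr.
  rewrite (bigD1 i) //= big1 ?addr0 => [|l nel].
    by rewrite !mxE (negPf nei) eqxx mul1r.
  by rewrite [Delta _ _]mxE (negPf nei) eq_sym (negPf nel) mul0r.
- rewrite (expand_det_col _ i0) (bigD1 i0) //= big1 => [|l nel].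
    rewrite colD eqxx mul1r addr0 /cofactor -signr_odd addnn odd_double expr0 mul1r.
    rewrite [X in \det X](_ : _ = 1%:M) ?det1 ?mulr1 //.
    apply/matrixP=> i j; rewrite !mxE eq_sym (negPf (neq_lift _ _)).
    by rewrite (inj_eq lift_inj).
  by rewrite colD (negPf nel) !mul0r.
- move=> v; pose c := (v 0 i0).[xi].
  have /dvdpP[q qE] : X %| v 0 i0 - c%:P.
    by rewrite dvdp_XsubCl /root !hornerE subrr.
  pose u : 'rV[{poly k}]_d := \row_j if j == i0 then q else v 0 j + q * (w 0 j)%:P.
  exists c, u; apply/rowP=> j; rewrite !mxE (bigD1 i0) //=.
  have [->|nej] := eqVneq j i0.
    rewrite big1 => [|l nel]; last by rewrite colD (negPf nel) mul0r mulr0.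
    by rewrite colD eqxx mul1r !mxE eqxx -qE mulr1 addr0 subrKC.
  rewrite (bigD1 j) //= big1 => [|l /andP[nel nelj]]; last first.
    by rewrite [Delta _ _]mxE (negPf nel) (negPf nelj) mulr0.
  rewrite !mxE !eqxx (negPf nej) mulr0 add0r addr0 mulr1.
  by ring.
Qed.

(** Induction on [r]: with [Phi = Delta *m Psi] from [det_root_factor], the cokernel of [Phi] is an
    extension of that of [Psi] by a line over [k], so each factor [X] adds one basis vector. At
    [r = 0] there is no torsion: the adjugate shows that [s] kills the cokernel, and [s] is coprime
    to [X ^+ n]. *)
Lemma torsion_basis d (Phi : 'M[{poly k}]_d) (s : {poly k}) r :
    \det Phi = X ^+ r * s -> ~~ root s xi ->
  exists g : 'I_r -> 'rV[{poly k}]_d,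
  [/\ forall c : 'I_r -> k,
        (exists u, \sum_i (c i)%:P *: g i = u *m Phi) -> forall i, c i = 0,
      forall w n, (exists u, X ^+ n *: w = u *m Phi) ->
        exists c u, w = \sum_i (c i)%:P *: g i + u *m Phi
    & forall i, exists u, X ^+ r *: g i = u *m Phi].
Proof.
elim: r Phi => [|r IHr] Phi detE sxi.
  exists (fun _ => 0); split=> [c _ [] // | w n [u uE] | [] //].
  have /Bezout_eq1_coprimepP[[a b] /= ab1] : coprimep (X ^+ n) s.
    by rewrite coprimep_expl // coprimep_sym coprimep_XsubC.
  exists (fun _ => 0), (a *: u + b *: (w *m \adj Phi)).
  rewrite big_ord0 add0r mulmxDl -!scalemxAl -uE -mulmxA mul_adj_mx detE.
  by rewrite expr0 mul1r mul_mx_scalar !scalerA -scalerDl ab1 scale1r.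
have [|i0 [Delta [Psi [PhiE detD colD spanD]]]] := @det_root_factor _ Phi.
  by rewrite detE exprS -mulrA rootM root_XsubC eqxx.
have detPsi : \det Psi = X ^+ r * s.
  apply/(mulfI (negbT (polyXsubC_eq0 xi))).
  by rewrite mulrA -exprS -detE PhiE det_mulmx detD.
have detPsi0 : \det Psi != 0.
  rewrite detPsi mulf_neq0 ?expf_neq0 ?polyXsubC_eq0 //.
  by apply: contraNneq sxi => ->; rewrite root0.
have PsiI (u v : 'rV_d) : u *m Psi = v *m Psi -> u = v.
  move=> /(congr1 (mulmx^~ (\adj Psi))); rewrite -!mulmxA mul_mx_adj !mul_mx_scalar.
  move=> /rowP uv; apply/rowP=> j; move: (uv j); rewrite !mxE.
  exact/mulfI.
have [g [g_free g_span g_tors]] := IHr _ detPsi sxi.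
pose g0 : 'rV[{poly k}]_d := delta_mx 0 i0 *m Psi.
have Xg0 : exists u, X *: g0 = u *m Phi.
  have [c [u uE]] := spanD (X *: delta_mx 0 i0).
  suff c0 : c = 0.
    by exists u; rewrite /g0 scalemxAl uE c0 scale0r add0r PhiE mulmxA.
  move/rowP: uE => /(_ i0); rewrite !mxE !eqxx (bigD1 i0) //= big1.
    rewrite colD eqxx !mul1r !mulr1 addr0 => /(congr1 (horner_eval xi)).
    by rewrite /horner_eval !hornerE subrr mulr0 addr0.
  by move=> l nel; rewrite colD (negPf nel) mul0r mulr0.
have sub_span v : exists c u, v *m Psi = c%:P *: g0 + u *m Phi.
  have [c [u uE]] := spanD v; exists c, u.
  by rewrite uE mulmxDl -scalemxAl PhiE mulmxA.
exists (fun i => if unlift ord0 i is Some j then g j else g0).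
have sumE (c : 'I_r.+1 -> k) :
    \sum_i (c i)%:P *: (if unlift ord0 i is Some j then g j else g0)
    = (c ord0)%:P *: g0 + \sum_i (c (lift ord0 i))%:P *: g i.
  rewrite big_ord_recl unlift_none; congr (_ + _).
  by apply: eq_bigr => i _; rewrite liftK.
split=> [c | w n [u uE] | i].
- rewrite sumE => -[u uE].
  have c'0 : forall i, c (lift ord0 i) = 0.
    apply: g_free; exists (u *m Delta - (c ord0)%:P *: delta_mx 0 i0).
    by rewrite mulmxBl -mulmxA -PhiE -uE -scalemxAl -/g0 addrAC subrr add0r.
  have c00 : c ord0 = 0.
    move: uE; rewrite big1 => [|i _]; last by rewrite c'0 scale0r.
    rewrite addr0 /g0 scalemxAl PhiE mulmxA => /PsiI /rowP /(_ i0).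
    rewrite !mxE !eqxx mulr1 (bigD1 i0) //= big1 => [|l nel].
      rewrite colD eqxx mul1r addr0 => /(congr1 (horner_eval xi)).
      by rewrite /horner_eval !hornerE subrr mulr0.
    by rewrite colD (negPf nel) mul0r mulr0.
  by move=> i; case: (unliftP ord0 i) => [j|] ->.
- have [|c [v wE]] := g_span w n; first by exists (u *m Delta); rewrite uE PhiE mulmxA.
  have [c0 [v0 v0E]] := sub_span v.
  exists (fun i => if unlift ord0 i is Some j then c j else c0), v0.
  rewrite sumE unlift_none wE v0E addrCA addrA; congr (_ + _ + _).
  by apply: eq_bigr => i _; rewrite liftK.
- case: unlift => [j|]; last first.
    by have [u uE] := Xg0; exists (X ^+ r *: u); rewrite exprSr -scalerA uE scalemxAl.
  have [u uE] := g_tors j; have [c [v vE]] := sub_span u.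
  have [u0 u0E] := Xg0; exists (c%:P *: u0 + X *: v).
  rewrite exprS -scalerA uE vE scalerDr scalerA mulrC -scalerA u0E.
  by rewrite mulmxDl -!scalemxAl.
Qed.

End TorsionBasis.

Lemma ideal2P (R : comNzRingType) (f g z : R) :
  reflect (exists a b, z = a * f + b * g) (z \in ideal2 f g).
Proof. exact: asboolP. Qed.

Lemma leq_add_pred a b c : (a <= b.-1 -> 0 < c -> (a + c).-1 <= b.-1 + c.-1)%N.
Proof. lia. Qed.

Lemma leq_add_predI a b c : (0 < b -> (a + b).-1 <= b.-1 + c.-1 -> a <= c.-1)%N.
Proof. lia. Qed.

Lemma rVpoly_Sylvester (R : comNzRingType) (P Q : {poly R}) u :
    (0 < size P)%N -> (0 < size Q)%N ->
  rVpoly (u *m Sylvester_mx P Q) = rVpoly (lsubmx u) * P + rVpoly (rsubmx u) * Q.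
Proof.
move=> P0 Q0; rewrite -[u in LHS]hsubmxK mul_row_col !mul_rV_lin1 /= linearD /=.
have su : (size (rVpoly (lsubmx u)) <= (size Q).-1)%N by exact: size_poly.
have sv : (size (rVpoly (rsubmx u)) <= (size P).-1)%N by exact: size_poly.
rewrite !poly_rV_K //; apply: leq_trans (size_polyMleq _ _) _.
  by rewrite [leqRHS]addnC; apply: (leq_add_pred sv Q0).
exact: (leq_add_pred su P0).
Qed.

(** * The quotient by two bivariate polynomials as a Sylvester cokernel *)

Section BivariateTorsion.
Variables (k : fieldType) (xi : k).
Local Notation X := ('X - xi%:P).
Variables (P Q : {poly {poly k}}) (r : nat) (s : {poly k}).
Hypotheses (P1 : (1 < size P)%N) (Q1 : (1 < size Q)%N).
Hypothesis Qlead : lead_coef Q \is a GRing.unit.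
Hypothesis resE : resultant P Q = X ^+ r * s.
Hypothesis s_xi : ~~ root s xi.

Let P0 : (0 < size P)%N := ltnW P1.
Let Q0 : (0 < size Q)%N := ltnW Q1.

(** The cofactors in [a * P + b * Q] may have any degree. Dividing [a] by [Q], legitimate because
    [lead_coef Q] is a unit, bounds the first one; the bound on [w] then bounds the second. *)
Lemma ideal2_Sylvester (w : {poly {poly k}}) :
    (size w <= (size Q).-1 + (size P).-1)%N -> w \in ideal2 P Q ->
  exists u, poly_rV w = u *m Sylvester_mx P Q.
Proof.
move=> szw /ideal2P[a [b wE]].
pose a' := a %% Q; pose b' := b + (a %/ Q) * P.
have wE' : w = a' * P + b' * Q.
  rewrite wE [in LHS](Pdiv.IdomainUnit.divp_eq Qlead a) /a' /b'; ring.
have Qn0 : Q != 0 by rewrite -size_poly_gt0.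
have sza' : (size a' <= (size Q).-1)%N by rewrite -ltnS prednK // ltn_modp.
have szb' : (size b' <= (size P).-1)%N.
  have [->|b'n0] := eqVneq b' 0; first by rewrite size_poly0.
  have: (size (b' * Q)%R <= (size Q).-1 + (size P).-1)%N.
    rewrite -[b' * Q](addKr (a' * P)) -wE'.
    rewrite (leq_trans (size_polyD _ _)) // geq_max szw andbT size_polyN.
    exact: leq_trans (size_polyMleq _ _) (leq_add_pred sza' P0).
  by rewrite size_mul //; apply: leq_add_predI.
exists (row_mx (poly_rV a') (poly_rV b')).
apply: (can_inj rVpolyK); rewrite rVpoly_Sylvester // row_mxKl row_mxKr.
by rewrite !poly_rV_K.
Qed.

Lemma Sylvester_ideal2 u : rVpoly (u *m Sylvester_mx P Q) \in ideal2 P Q.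
Proof. by rewrite rVpoly_Sylvester //; apply/ideal2P; do 2!eexists. Qed.

Lemma resultant_ideal2 : (resultant P Q)%:P \in ideal2 P Q.
Proof. by have [[a b] _ /= E] := resultant_in_ideal P1 Q1; apply/ideal2P; exists a, b. Qed.

(** Division by [Q] gives each class a representative of low degree, so the quotient by [(P, Q)] is
    the cokernel of [Sylvester_mx P Q] over [k[x]], and [torsion_basis] applies with the resultant
    as determinant. *)
Lemma bivariate_torsion_basis :
  exists g : 'I_r -> {poly {poly k}},
  [/\ forall c : 'I_r -> k,
        \sum_i (c i)%:P%:P * g i \in ideal2 P Q -> forall i, c i = 0,
      forall w n, X%:P ^+ n * w \in ideal2 P Q ->
        exists c, w - \sum_i (c i)%:P%:P * g i \in ideal2 P Q
    & forall i, X%:P ^+ r * g i \in ideal2 P Q].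
Proof.
have [g [g_free g_span g_tors]] := torsion_basis resE s_xi.
pose g' i := rVpoly (g i).
have g'E (c : 'I_r -> k) : \sum_i (c i)%:P%:P * g' i = rVpoly (\sum_i (c i)%:P *: g i).
  by rewrite linear_sum; apply: eq_bigr => i _; rewrite linearZ mul_polyC.
exists g'; split=> [c | w n | i].
- rewrite g'E => /ideal2_Sylvester[|u uE]; first exact: size_poly.
  by apply: g_free; exists u; rewrite -uE rVpolyK.
- move=> wI; pose w' := w %% Q.
  have w'w : w - w' \in ideal2 P Q.
    apply/ideal2P; exists 0, (w %/ Q); rewrite mul0r add0r.
    by rewrite {1}(Pdiv.IdomainUnit.divp_eq Qlead w) addrK.
  have szw' : (size w' <= (size Q).-1 + (size P).-1)%N.
    by rewrite (leq_trans _ (leq_addr _ _)) // -ltnS prednK // ltn_modp -size_poly_gt0.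
  have /ideal2_Sylvester[|u uE] : (X ^+ n)%:P * w' \in ideal2 P Q.
  - rewrite rmorphXn /= -[w'](subKr w) mulrBr rpredB // ideal2M //.
  - by rewrite mul_polyC (leq_trans (size_scale_leq _ _)).
  have [|c [v wE]] := g_span (poly_rV w') n.
    by exists u; rewrite -uE mul_polyC linearZ.
  exists c; rewrite -[w](subrK w') -addrA rpredD // g'E -[w'](poly_rV_K szw') wE.
  by rewrite linearD /= addrC addKr Sylvester_ideal2.
- have [u uE] := g_tors i.
  by rewrite -rmorphXn mul_polyC /g' -linearZ uE Sylvester_ideal2.
Qed.

End BivariateTorsion.

(** * Local algebra of two bivariate polynomials at a point *)

(* In [{poly {poly R}}] the outer variable is y and the inner one is x, so
   [p.[b%:P].[a]] is the value of p at x = a, y = b. *)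
Lemma horner2_swap (R : comNzRingType) (p : {poly {poly R}}) a b :
  p.[b%:P].[a] = (map_poly (horner_eval a) p).[b].
Proof. by rewrite -[b in RHS](hornerC b a) -horner_evalE horner_map. Qed.

Section LocalUnit.
Variable k : fieldType.

Lemma horner2_factor (p : {poly {poly k}}) a : map_poly (horner_eval a) p = 0 ->
  exists q, p = ('X - a%:P)%:P * q.
Proof.
move=> p0; exists (\poly_(i < size p) (p`_i %/ ('X - a%:P))).
apply/polyP=> i; rewrite coefCM coef_poly; case: ltnP => [_|?].
  rewrite mulrC divpK // dvdp_XsubCl /root.
  by move/polyP: p0 => /(_ i); rewrite coef_map coef0 => /eqP.
by rewrite mulr0 nth_default.
Qed.

Hypothesis rootk : forall p : {poly k}, (1 < size p)%N -> exists x, root p x.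

Lemma coprime_no_common_root (p q u : {poly k}) : p != 0 ->
    (forall y, root p y -> root q y -> ~~ root u y) ->
  exists a b c, a * p + b * q + c * u = 1.
Proof.
move=> p0 nroot; have /Bezout_eq1_coprimepP[[a c] /= ac1] : coprimep (gcdp p q) u.
  rewrite coprimep_def eqn_leq size_poly_gt0 !gcdp_eq0 (negPf p0) /= andbT leqNgt.
  apply/negP => /rootk[y]; rewrite !root_gcd => /andP[/andP[py qy]].
  by apply/negP; apply: nroot.
have [[a' b'] /= /eqpP[[c1 c2] /= /andP[c1n0 c2n0] gE]] := Bezoutp p q.
exists (c2^-1 *: (c1 *: a') * a), (c2^-1 *: (c1 *: b') * a), c.
rewrite -ac1 [in RHS](_ : gcdp p q = c2^-1 *: (c1 *: (a' * p + b' * q))); last first.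
  by rewrite gE scalerA mulVf // scale1r.
by rewrite -!mul_polyC; ring.
Qed.

Variables (P Q : {poly {poly k}}) (xi eta : k).
Local Notation X := ('X - xi%:P).
Hypothesis Qxi : map_poly (horner_eval xi) Q != 0.
Hypothesis uniq_eta : forall y, P.[y%:P].[xi] = 0 -> Q.[y%:P].[xi] = 0 -> y = eta.

(** Invertibility of [u] modulo [(P, Q, X^n)]. On the line [x = xi] the three polynomials [P], [Q],
    [u] have no common root, hence generate 1; lifting this identity leaves an error divisible by
    [X], and using it repeatedly raises the power of [X]. *)
Lemma local_unit (u : {poly {poly k}}) n : u.[eta%:P].[xi] != 0 ->
  exists a b, 1 - a * u - b * X%:P ^+ n \in ideal2 P Q.
Proof.
move=> u0.
have [a [b [c abc]]] : exists a b c, a * map_poly (horner_eval xi) Q +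
    b * map_poly (horner_eval xi) P + c * map_poly (horner_eval xi) u = 1.
  apply: coprime_no_common_root => // y; rewrite !rootE -!horner2_swap => /eqP Qy /eqP Py.
  by rewrite (uniq_eta Py Qy).
pose C (v : {poly k}) := map_poly (polyC : k -> {poly k}) v.
have CK v : map_poly (horner_eval xi) (C v) = v.
  by rewrite -map_poly_comp map_poly_id // => x _ /=; rewrite /horner_eval hornerC.
have [|t tE] := @horner2_factor (1 - C a * Q - C b * P - C c * u) xi.
  by rewrite !(rmorphB, rmorphM, rmorph1) /= !CK -abc; ring.
elim: n => [|n [a' [b' ab']]].
  by exists 0, 1; rewrite mul0r subr0 expr0 mulr1 subrr rpred0.
exists (a' + b' * X%:P ^+ n * C c), (b' * t).
rewrite [X in X \in _](_ : _ =
  (1 - a' * u - b' * X%:P ^+ n) + b' * X%:P ^+ n * (C a * Q + C b * P)).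
  by rewrite rpredD // ideal2M //; apply/ideal2P; exists (C b), (C a); rewrite addrC.
have -> : C a * Q + C b * P = 1 - C c * u - X%:P * t by rewrite -tE; ring.
by rewrite exprS; ring.
Qed.

End LocalUnit.

(** * Multiplicity of the resultant at a zero with nonvanishing Jacobian *)

Section SimpleRoot.
Variables (k : fieldType) (xi eta : k).
Local Notation X := ('X - xi%:P).
Local Notation Y := ('X - (eta%:P)%:P : {poly {poly k}}).

Definition partial1 (f : {poly {poly k}}) := (f.[eta%:P])^`().[xi].
Definition partial2 (f : {poly {poly k}}) := f^`().[eta%:P].[xi].

Lemma poly_taylor1 (R : comNzRingType) (p : {poly R}) a :
  exists q, p = (p.[a])%:P + q * ('X - a%:P) /\ q.[a] = p^`().[a].
Proof.
have /factor_theorem[q qE] : root (p - (p.[a])%:P) a by rewrite /root !hornerE subrr.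
have pE : p = (p.[a])%:P + q * ('X - a%:P) by rewrite -qE subrKC.
exists q; split=> //; rewrite [in RHS]pE derivD derivC derivM derivXsubC !hornerE.
by rewrite subrr mulr0 !add0r.
Qed.

Lemma taylor2 (f : {poly {poly k}}) : exists m1 m2,
  [/\ f = (f.[eta%:P].[xi])%:P%:P + m1 * X%:P + m2 * Y,
      m1.[eta%:P].[xi] = partial1 f & m2.[eta%:P].[xi] = partial2 f].
Proof.
have [h [fE hE]] := poly_taylor1 f eta%:P.
have [h0 [gE h0E]] := poly_taylor1 f.[eta%:P] xi.
exists h0%:P, h; split; last by rewrite hE.
  by rewrite [LHS]fE [in LHS]gE rmorphD rmorphM.
by rewrite hornerC h0E.
Qed.

Hypothesis rootk : forall p : {poly k}, (1 < size p)%N -> exists x, root p x.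
Variables (P Q : {poly {poly k}}) (r : nat) (s : {poly k}).
Hypotheses (P1 : (1 < size P)%N) (Q1 : (1 < size Q)%N).
Hypothesis Qlead : lead_coef Q \is a GRing.unit.
Hypothesis resE : resultant P Q = X ^+ r * s.
Hypothesis s_xi : ~~ root s xi.
Hypothesis Qxi : map_poly (horner_eval xi) Q != 0.
Hypothesis uniq_eta : forall y, P.[y%:P].[xi] = 0 -> Q.[y%:P].[xi] = 0 -> y = eta.
Hypotheses (Pz : P.[eta%:P].[xi] = 0) (Qz : Q.[eta%:P].[xi] = 0).
Hypothesis jacobian : partial1 P * partial2 Q - partial2 P * partial1 Q != 0.

(* By Cramer's rule the Jacobian determinant, corrected by elements vanishing at
   (xi, eta), multiplies X and Y into the ideal, and it is a local unit. *)
Lemma maximal_ideal_kills_torsion t : X%:P ^+ r * t \in ideal2 P Q ->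
  X%:P * t \in ideal2 P Q /\ Y * t \in ideal2 P Q.
Proof.
move=> tors; have [m11 [m12 [PE m11z m12z]]] := taylor2 P.
have [m21 [m22 [QE m21z m22z]]] := taylor2 Q.
rewrite Pz polyC0 add0r in PE; rewrite Qz polyC0 add0r in QE.
pose delta := m11 * m22 - m12 * m21.
have dz : delta.[eta%:P].[xi] != 0 by rewrite !hornerE m11z m12z m21z m22z.
have [a [b abI]] := local_unit rootk Qxi uniq_eta r dz.
have dX : delta * X%:P \in ideal2 P Q.
  by apply/ideal2P; exists m22, (- m12); rewrite PE QE /delta; ring.
have dY : delta * Y \in ideal2 P Q.
  by apply/ideal2P; exists (- m21), m11; rewrite PE QE /delta; ring.
suff kill Z : delta * Z \in ideal2 P Q -> Z * t \in ideal2 P Q by split; apply: kill.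
move=> dZ; rewrite (_ : Z * t = Z * t * (1 - a * delta - b * X%:P ^+ r)
  + (a * t * (delta * Z) + b * Z * (X%:P ^+ r * t))); last by ring.
by apply: rpredD; [|apply: rpredD]; apply: ideal2M.
Qed.

(* The idempotent [e] cuts out the torsion part, which is then spanned by [e]. *)
Lemma simple_root : (r <= 1)%N.
Proof.
have [g [g_free g_span g_tors]] := bivariate_torsion_basis P1 Q1 Qlead resE s_xi.
(* As [a X^r + b s = 1], the element [b s] is 1 modulo [X^r], and [X^r] kills it modulo the ideal
   since [X^r s] is the resultant: it is the unit of the torsion part. *)
have /Bezout_eq1_coprimepP[[a b] /= ab1] : coprimep (X ^+ r) s.
  by rewrite coprimep_expl // coprimep_sym coprimep_XsubC.
pose e : {poly {poly k}} := (b * s)%:P.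
have e_tors : X%:P ^+ r * e \in ideal2 P Q.
  rewrite -rmorphXn -rmorphM mulrCA -resE rmorphM ideal2M //.
  exact: resultant_ideal2.
have [Xe Ye] := maximal_ideal_kills_torsion e_tors.
have gE i : g i - ((g i).[eta%:P].[xi])%:P%:P * e \in ideal2 P Q.
  have [m1 [m2 [giE _ _]]] := taylor2 (g i).
  rewrite (_ : _ - _ = a%:P * (X%:P ^+ r * g i) + (m1 * (X%:P * e) + m2 * (Y * e))).
    by apply: rpredD; [|apply: rpredD]; apply: ideal2M.
  set c := _%:P%:P in giE *.
  have -> : c = g i - m1 * X%:P - m2 * Y by rewrite {1}giE; ring.
  rewrite (_ : a%:P * _ = (1 - e) * g i); first by ring.
  by rewrite mulrA -rmorphXn -rmorphM /e -polyC1 -rmorphB -ab1 addrK.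
rewrite leqNgt; apply/negP => r1.
pose i0 := Ordinal (ltnW r1); pose i1 := Ordinal r1.
have i10 : i1 != i0 by [].
(* By [gE], two basis vectors would both be multiples of [e], hence proportional through their
   values at the zero; freeness then forces [v i0 = 0], which puts [g i0] in the ideal. *)
pose v i := (g i).[eta%:P].[xi].
pose c i := if i == i0 then v i1 else if i == i1 then - v i0 else 0.
have cI : \sum_i (c i)%:P%:P * g i \in ideal2 P Q.
  rewrite (bigD1 i0) //= (bigD1 i1) //= big1 => [|i /andP[/negPf ni0 /negPf ni1]]; last first.
    by rewrite /c ni0 ni1 !polyC0 mul0r.
  rewrite /c eqxx (negPf i10) eqxx.
  rewrite (_ : _ + _ = (v i1)%:P%:P * (g i0 - (v i0)%:P%:P * e)
                     - (v i0)%:P%:P * (g i1 - (v i1)%:P%:P * e)).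
    by apply: rpredB; apply: ideal2M.
  by rewrite !polyCN; ring.
have v0 : v i0 = 0.
  by apply: oppr_inj; rewrite oppr0; have := g_free _ cI i1; rewrite /c (negPf i10) eqxx.
have := g_free (fun i => (i == i0)%:R) _ i0; rewrite eqxx => c1.
suff /c1/eqP : \sum_i ((i == i0)%:R%:P)%:P * g i \in ideal2 P Q by rewrite oner_eq0.
rewrite (bigD1 i0) //= big1 => [|i /negPf ->]; last by rewrite !polyC0 mul0r.
rewrite /= !polyC1 mul1r addr0; by have := gE i0; rewrite -/(v i0) v0 !polyC0 mul0r subr0.
Qed.

End SimpleRoot.

(** * Common zeros and common factors through the resultant *)

Section CommonRoots.
Variable k : fieldType.
Hypothesis rootk : forall p : {poly k}, (1 < size p)%N -> exists x, root p x.
Implicit Types P Q G a : {poly {poly k}}.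

Lemma unit_horner_neq0 (c : {poly k}) x : c \is a GRing.unit -> c.[x] != 0.
Proof.
rewrite poly_unitE => /andP[/size_poly1P[c0 c00 ->] _].
by rewrite hornerC.
Qed.

Lemma unit_lead_horner_neq0 Q x : lead_coef Q \is a GRing.unit ->
  map_poly (horner_eval x) Q != 0.
Proof.
move=> leadQ; apply: contraTneq (unit_horner_neq0 x leadQ) => /polyP/(_ (size Q).-1).
by rewrite coef_map coef0 => h; rewrite negbK; apply/eqP.
Qed.

(* Gauss's lemma: the roots of [c] are divided out one at a time. *)
Lemma scaled_factor n (c : {poly k}) P a G : (size c <= n)%N -> c != 0 ->
  c *: P = a * G -> exists e a1 G1, [/\ e != 0, G = e *: G1 & P = a1 * G1].
Proof.
elim: n c a G => [|n IHn] c a G szc c0 cP.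
  by move: szc; rewrite leqNgt size_poly_gt0 c0.
have [sz1|sz1] := ltnP 1 (size c); last first.
  have /size_poly1P[c' c'0 cE] : size c == 1%N by rewrite eqn_leq sz1 size_poly_gt0.
  exists 1, (c'^-1%:P *: a), G; rewrite oner_eq0 scale1r; split=> //.
  by rewrite -scalerAl -cP scalerA cE -polyCM mulVf // scale1r.
have [z cz] := rootk sz1.
have /dvdpP[c' c'E] : ('X - z%:P) %| c by rewrite dvdp_XsubCl.
have c'0 : c' != 0 by apply: contraNneq c0; rewrite c'E => ->; rewrite mul0r.
have szc' : (size c' <= n)%N.
  by move: szc; rewrite c'E size_mul ?polyXsubC_eq0 // size_XsubC addn2.
have cancelX U V : ('X - z%:P)%:P * U = ('X - z%:P)%:P * V -> U = V.
  by apply: mulfI; rewrite polyC_eq0 polyXsubC_eq0.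
have : map_poly (horner_eval z) a * map_poly (horner_eval z) G == 0.
  rewrite -rmorphM -cP -mul_polyC rmorphM /= map_polyC /= /horner_eval.
  by move: cz => /eqP ->; rewrite mul0r.
rewrite mulf_eq0 => /orP[] /eqP /horner2_factor[t tE].
  apply: (IHn c' t G) => //; apply: cancelX.
  by rewrite mulrA -tE -cP c'E -!mul_polyC polyCM; ring.
have [|e [a1 [G1 [e0 tE1 PE]]]] := IHn c' a t szc' c'0.
  apply: cancelX.
  by rewrite mulrCA -tE -cP c'E -!mul_polyC polyCM; ring.
exists (('X - z%:P) * e), a1, G1; rewrite mulf_neq0 ?polyXsubC_eq0 //.
by rewrite tE tE1 mul_polyC scalerA.
Qed.

(** A vanishing resultant only gives a gcd over [k(x)], defined up to factors in [x].
    [scaled_factor] removes these; the remaining factor has unit leading coefficient because it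
    divides [P], so that it divides [Q] in [k[x][y]] too. *)
Lemma resultant_common_factor P Q :
    lead_coef P \is a GRing.unit -> resultant P Q = 0 ->
  exists d a b : {poly {poly k}}, [/\ (1 < size d)%N, P = d * a & Q = d * b].
Proof.
move=> leadP /eqP; rewrite resultant_eq0 => szG.
have /Pdiv.Idomain.dvdpP[[c a] /= c0 cP] := dvdp_gcdl P Q.
have [e [a1 [G1 [e0 GE PE]]]] := scaled_factor (leqnn _) c0 cP.
exists G1, a1, (Q %/ G1); split.
- by move: szG; rewrite GE size_scale.
- by rewrite mulrC.
have G1u : lead_coef G1 \is a GRing.unit.
  by move: leadP; rewrite PE lead_coefM unitrM => /andP[].
have : G1 %| Q.
  by rewrite -(dvdpZl _ _ e0) -GE dvdp_gcdr.
move=> /modp_eq0P QG; rewrite [LHS](Pdiv.IdomainUnit.divp_eq G1u Q).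
by rewrite QG addr0 mulrC.
Qed.

(** Unit leading coefficients survive the substitution [x = xi], so the resultant commutes with it,
    and a root of the gcd of the specialised polynomials provides [eta]. *)
Lemma resultant_root P Q xi :
    lead_coef P \is a GRing.unit -> lead_coef Q \is a GRing.unit ->
  root (resultant P Q) xi -> exists eta, P.[eta%:P].[xi] = 0 /\ Q.[eta%:P].[xi] = 0.
Proof.
move=> leadP leadQ; rewrite /root -horner_evalE map_resultant ?unit_horner_neq0 //.
rewrite resultant_eq0 => /rootk[eta]; rewrite root_gcd => /andP[/eqP Pe /eqP Qe].
by exists eta; rewrite !horner2_swap Pe Qe.
Qed.

Lemma root_resultant P Q xi eta : (1 < size P)%N -> (1 < size Q)%N ->
  P.[eta%:P].[xi] = 0 -> Q.[eta%:P].[xi] = 0 -> root (resultant P Q) xi.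
Proof.
move=> P1 Q1 Pz Qz; have /ideal2P[a [b abE]] := resultant_ideal2 P1 Q1.
rewrite /root -[resultant P Q](hornerC _ eta%:P) abE.
by rewrite !hornerE Pz Qz !mulr0 addr0.
Qed.

Lemma common_zeros_finite P Q : (1 < size P)%N -> (1 < size Q)%N ->
    lead_coef Q \is a GRing.unit -> resultant P Q != 0 ->
  exists zs : seq (k * k), forall x y, P.[y%:P].[x] = 0 -> Q.[y%:P].[x] = 0 ->
    (x, y) \in zs.
Proof.
move=> P1 Q1 leadQ res0.
(* If no list contained all the roots, lists of distinct roots of every length could be grown,
   against [max_poly_roots]. *)
have rootsP (K : fieldType) (p : {poly K}) : p != 0 -> exists rs : seq K, forall x, root p x -> x
  \in rs.
  move=> p0; case: (pselect (exists rs : seq K, forall x, root p x -> x \in rs)) => // nex.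
  suff H n : exists rs, [/\ uniq rs, all (root p) rs & size rs = n].
    have [rs [urs ars szrs]] := H (size p).
    by have := max_poly_roots p0 ars urs; rewrite szrs ltnn.
  elim: n => [|n [rs [urs ars szrs]]]; first by exists [::].
  have [x [px xrs]] : exists x, root p x /\ x \notin rs.
    apply: contrapT => H; apply: nex; exists rs => x px; apply: contrapT => /negP xrs.
    by apply: H; exists x.
  by exists (x :: rs); rewrite /= xrs urs px ars szrs.
have [xs xsP] := rootsP _ _ res0.
have Qx0 x := unit_lead_horner_neq0 x leadQ.
have [ys ysP] : {ys : k -> seq k & forall x y, root (map_poly (horner_eval x) Q) y -> y \in ys x}.
  by apply: (@choice _ _ (fun x ys => forall y, root (map_poly (horner_eval x) Q) y -> y \in ys))
    => x; apply: rootsP.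
exists [seq (x, y) | x <- xs, y <- ys x] => x y Px Qx.
apply/allpairsPdep; exists x, y; split=> //.
  by apply: xsP; apply: root_resultant Px Qx.
by apply: ysP; rewrite rootE -horner2_swap Qx.
Qed.

End CommonRoots.

(** * Length and dimension *)

Section LengthDimension.
Variables (k : fieldType) (A : comNzRingType) (M : lmodType A) (m : nat).
Variables (iota : {rmorphism k -> A}) (t0 t1 : A) (phi : {additive M -> 'rV[k]_m}).
Hypothesis local_decomp : forall f, exists c f0 f1, f = iota c + t0 * f0 + t1 * f1.
Hypothesis local_inv : forall c f0 f1, c != 0 ->
  exists g, g * (iota c + t0 * f0 + t1 * f1) = 1.
Hypothesis phiZ : forall c v, phi (iota c *: v) = c *: phi v.
Hypothesis phi_inj : forall v, phi v = 0 -> v = 0.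
Hypothesis phi_surj : forall u, exists v, phi v = u.

Lemma submodule_sum (N : M -> Prop) I (r : seq I) (P : pred I) (F : I -> M) :
  submodule N -> (forall i, P i -> N (F i)) -> N (\sum_(i <- r | P i) F i).
Proof.
move=> [N0 ND] NF; elim/big_rec: _ => // i x Pi Nx.
by rewrite -[F i]scale1r; apply: ND => //; apply: NF.
Qed.

Lemma submoduleZ (N : M -> Prop) a v : submodule N -> N v -> N (a *: v).
Proof. by move=> [N0 ND] Nv; rewrite -[_ *: _]addr0; apply: ND. Qed.

(** Vectors [x i] picked in each step of the chain outside the previous one are independent over
    [k]: in a relation, the last one with nonzero coefficient would lie in the smaller submodule. *)
Lemma submodule_chain_bound m' (N : 'I_m'.+1 -> M -> Prop) :
  submodule_chain N -> (m' <= m)%N.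
Proof.
move=> [Nsub Nlt].
have /choice[x xP] (i : 'I_m') : exists x,
    N (lift ord0 i) x /\ ~ N (widen_ord (leqnSn m') i) x.
  have [|_ [x]] := Nlt (widen_ord (leqnSn m') i) (lift ord0 i).
    by rewrite /= /bump.
  by exists x.
pose V := \matrix_i phi (x i).
suff : row_free V by rewrite -row_leq_rank => /leq_trans; apply; apply: rank_leq_col.
rewrite -kermx_eq0; apply/eqP/row_matrixP => i; rewrite row0.
set c := row i _; have cV : c *m V = 0 by apply/sub_kermxP; apply: row_sub.
move: (c) cV => {i}{}c cV.
have sum0 : \sum_i iota (c 0 i) *: x i = 0.
  apply: phi_inj; rewrite raddf_sum -[RHS]cV mulmx_sum_row.
  by apply: eq_bigr => i _; rewrite phiZ rowK.
apply/eqP/negPn/negP => c_neq0.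
have [i0 ci0] : exists i, c 0 i != 0.
  apply/existsP; apply: contraNT c_neq0 => /existsPn c0; apply/eqP/rowP => i.
  by rewrite mxE; apply/eqP/negPn/c0.
pose i := [arg max_(j > i0 | (c 0 j != 0)%R) j]%N.
have [ci imax] : c 0 i != 0 /\ forall j, c 0 j != 0 -> (j <= i)%N.
  by rewrite /i; case: arg_maxnP.
case: (xP i) => _; apply.
have -> : x i = iota (- (c 0 i)^-1) *: \sum_(j | j != i) iota (c 0 j) *: x j.
  have : iota (c 0 i) *: x i = - \sum_(j | j != i) iota (c 0 j) *: x j.
    by apply/eqP; rewrite -addr_eq0 -[X in _ == X]sum0 [X in _ == X](bigD1 i).
  move/(congr1 (GRing.scale (iota (c 0 i)^-1))).
  by rewrite scalerA -rmorphM mulVf // rmorph1 scale1r => ->; rewrite scalerN rmorphN scaleNr.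
apply: submoduleZ; first exact: Nsub.
apply: submodule_sum => [|j ji]; first exact: Nsub.
have [->|cj] := eqVneq (c 0 j) 0; first by rewrite rmorph0 scale0r;
  case: (Nsub (widen_ord (leqnSn m') i)).
apply: submoduleZ => //.
have lt_ji : (j < i)%N by rewrite ltn_neqAle imax // ji.
have [+ _] := xP j.
move: lt_ji; rewrite leq_eqVlt => /orP[/eqP ij|lt_ji].
  by congr (N _ _); apply: val_inj; rewrite /= /bump.
by have [|sub _] := Nlt (lift ord0 j) (widen_ord (leqnSn m') i); last exact: sub.
Qed.

(** The [m + 1] vectors [t ^+ i *: v] with [i <= m] are dependent over [k], so a nonzero polynomial
    in [t] kills [v]. Up to a power of [t] it has nonzero constant term, and is then a unit. *)
Lemma nilpotent_action (t : A) (v : M) : (forall c f, c != 0 -> exists g, g * (iota c + t * f) =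
  1) ->
  exists b, t ^+ b *: v = 0.
Proof.
move=> t_unit; pose V := \matrix_(i < m.+1) phi (t ^+ i *: v).
have : kermx V != 0.
  rewrite kermx_eq0 -row_leq_rank -ltnNge ltnS; exact: rank_leq_col.
case/rowV0Pn => c /sub_kermxP cV c0.
pose p := rVpoly c.
have p0 : p != 0.
  by apply: contraNneq c0 => /(congr1 (@poly_rV _ m.+1)); rewrite /p rVpolyK linear0 => ->.
have pv : (map_poly iota p).[t] *: v = 0.
  apply: phi_inj; rewrite (@horner_coef_wide _ m.+1); last first.
    by rewrite (leq_trans (size_poly _ _)) // size_poly.
  rewrite scaler_suml raddf_sum -[RHS]cV mulmx_sum_row.
  by apply: eq_bigr => i _; rewrite -scalerA coef_map phiZ rowK coef_rVpoly_ord.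
have [b [q]] := multiplicity_XsubC p 0; rewrite p0 /= subr0 => q0 pE.
have [h hE] : exists h, map_poly iota q = (iota q.[0])%:P + h * 'X.
  have /factor_theorem[h hE] : root (map_poly iota q - (iota q.[0])%:P) 0.
    by rewrite /root !hornerE -[0 in X in X - _](rmorph0 iota) horner_map subrr.
  by exists h; rewrite -[LHS](subrK (iota q.[0])%:P) hE subr0 addrC.
have [g gE] := t_unit q.[0] h.[t] q0; exists b.
rewrite -[LHS]scale1r -gE -[RHS](scaler0 _ g) -pv !scalerA pE rmorphM rmorphXn /= map_polyX hE.
by rewrite !hornerE [t * _]mulrC.
Qed.

(* A vector outside [N], multiplied by the largest powers of t0 and then t1 that
   keep it outside [N], becomes a socle element of the quotient by [N]. *)
Lemma chain_extend j (N : M -> Prop) (v : 'I_j -> M) : (j < m)%N -> submodule N ->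
    (forall x, N x -> exists c : 'I_j -> k, x = \sum_i iota (c i) *: v i) ->
  exists x, [/\ ~ N x, N (t0 *: x) & N (t1 *: x)].
Proof.
move=> lt_jm Nsub Nspan.
have [x xN] : exists x, ~ N x.
  apply: contrapT => /forallNP allN.
  have {allN}allN x : N x by apply: contrapT; apply: allN.
  pose V := \matrix_i phi (v i).
  suff : row_full V by rewrite -col_leq_rank => /leq_trans/(_ (rank_leq_row _));
    rewrite leqNgt lt_jm.
  rewrite -sub1mx; apply/row_subP => i; have [x xE] := phi_surj (row i 1%:M).
  have [c cE] := Nspan x (allN x).
  rewrite -xE cE raddf_sum; apply/submxP; exists (\row_i c i).
  rewrite mulmx_sum_row; apply: eq_bigr => l _.
  by rewrite phiZ rowK mxE.
have last_step t y : (forall c f, c != 0 -> exists g, g * (iota c + t * f) = 1) -> ~ N y ->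
  exists b, ~ N (t ^+ b *: y) /\ N (t *: (t ^+ b *: y)).
  move=> t_unit yN; have [b tb] := nilpotent_action y t_unit.
  have exb : exists b, `[< N (t ^+ b *: y) >].
    by exists b; apply/asboolP; rewrite tb; case: Nsub.
  have [[|b'] /asboolP Nb bmin] := ex_minnP exb; first by case: yN; rewrite -[y]scale1r.
  exists b'; split; last by rewrite scalerA -exprS.
  by move=> /asboolP/bmin; rewrite ltnn.
have [||b0 [x0N x0t]] := @last_step t0 x.
- by move=> c f c0; have [g gE] := local_inv f 0 c0; exists g; rewrite -gE mulr0 addr0.
- exact: xN.
have [||b1 [x1N x1t]] := @last_step t1 (t0 ^+ b0 *: x).
- by move=> c f c0; have [g gE] := local_inv 0 f c0; exists g; rewrite -gE mulr0 addr0.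
- exact: x0N.
exists (t1 ^+ b1 *: (t0 ^+ b0 *: x)); split=> //.
by rewrite scalerA mulrC -scalerA; apply: submoduleZ.
Qed.

(** The vector [x] of [chain_extend] makes [N + k x] stable under [A]: by [local_decomp] a scalar
    acts on [x] through its residue in [k], up to elements of [N]. Each step adds one spanning
    vector, so the flag cannot fill [M] before step [m]. *)
Lemma submodule_flag j : (j <= m)%N -> exists (N : nat -> M -> Prop) (v : 'I_j -> M),
  [/\ forall i, submodule (N i),
      forall i, (i < j)%N -> (forall x, N i x -> N i.+1 x) /\ exists2 x, N i.+1 x & ~ N i x
    & forall x, N j x -> exists c : 'I_j -> k, x = \sum_i iota (c i) *: v i].
Proof.
elim: j => [|j IHj] lt_jm.
  exists (fun _ x => x = 0), (fun _ => 0); split=> // [_|x ->].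
    by split=> // a x y -> ->; rewrite scaler0 addr0.
  by exists (fun _ => 0); rewrite big_ord0.
have [N [v [Nsub Nlt Nspan]]] := IHj (ltnW lt_jm).
have [x [xN x0 x1]] := chain_extend lt_jm (Nsub j) Nspan.
pose N' y := exists c n, N j n /\ y = n + iota c *: x.
exists (fun i => if (i <= j)%N then N i else N'), (fun i => oapp v x (unlift ord_max i)).
have N'sub : submodule N'.
  have [N0 ND] := Nsub j; split; first by exists 0, 0; rewrite rmorph0 scale0r addr0.
  move=> a y z [c [n [Nn ->]]] [c' [n' [Nn' ->]]].
  have [c0 [f0 [f1 aE]]] := local_decomp a.
  exists (c0 * c + c'), ((iota c * f0) *: (t0 *: x) + ((iota c * f1) *: (t1 *: x) + (a *: n + n'))).
  split; first by do 3!apply: (ND) => //.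
  rewrite scalerDr scalerA rmorphD rmorphM /= !scalerA !scalerDl.
  have -> : (a * iota c) *: x = (iota c0 * iota c) *: x +
      ((iota c * f0 * t0) *: x + (iota c * f1 * t1) *: x).
    by rewrite -!scalerDl aE; congr (_ *: x); ring.
  move: (_ *: n) (_ *: x) (_ *: x) (_ *: x) (_ *: x) => U B C D F.
  by rewrite addrACA (addrAC F) [LHS]addrCA [RHS]addrC [U + n' + (_ + _)]addrC -(addrA D).
have N'x : N' x.
  by exists 1, 0; rewrite rmorph1 scale1r add0r; case: (Nsub j).
have NN' y : N j y -> N' y by exists 0, y; rewrite rmorph0 scale0r addr0.
split=> [i | i | y].
- by case: ifP.
- move=> lt_ij1; have : (i == j) || (i < j)%N by rewrite -leq_eqVlt.
  case/orP => [/eqP -> | lt_ij].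
    by rewrite leqnn ltnn; split=> //; exists x.
  by rewrite lt_ij (ltnW lt_ij); apply: Nlt.
- rewrite ltnn => -[c [n [/Nspan[c' ->] ->]]].
  exists (fun i => oapp c' c (unlift ord_max i)).
  rewrite big_ord_recr /= unlift_none /=; congr (_ + _).
  apply: eq_bigr => i _; suff -> : widen_ord (leqnSn j) i = lift ord_max i by rewrite liftK.
  by apply: val_inj; rewrite /= /bump leqNgt ltn_ord.
Qed.

Lemma has_length_dim : has_length M m.
Proof.
split=> [|m' N]; last exact: submodule_chain_bound.
have [N [v [Nsub Nlt _]]] := submodule_flag (leqnn m).
exists (fun i => N i); split=> // i j lt_ij.
have mono a b : (a <= b)%N -> (b <= m)%N -> forall x, N a x -> N b x.
  elim: b => [|b IHb]; first by rewrite leqn0 => /eqP ->.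
  rewrite leq_eqVlt => /orP[/eqP -> //|le_ab] lt_bm x Nax.
  by have [sub _] := Nlt b lt_bm; apply/sub/IHb => //; apply: ltnW.
have lt_im : (i < m)%N by rewrite (leq_trans lt_ij) // -ltnS.
split=> [x|]; first by apply: mono; [apply: ltnW|rewrite -ltnS].
have [_ [x xN xN']] := Nlt i lt_im; exists x => //.
by apply: mono xN; rewrite // -ltnS.
Qed.
End LengthDimension.

(** * Shears of the plane *)

Lemma mpoly_rmorph_ext (R : comNzRingType) (S : comNzRingType) n
    (f g : {rmorphism {mpoly R[n]} -> S}) :
  (forall c, f c%:MP = g c%:MP) -> (forall i, f 'X_i = g 'X_i) -> f =1 g.
Proof.
move=> fgC fgX; apply: mpolyind => [|c m p _ _ fgp]; first by rewrite !rmorph0.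
rewrite !rmorphD fgp -mul_mpolyC !rmorphM fgC mpolyXE_id; congr (_ * _ + _).
by rewrite !rmorph_prod; apply: eq_bigr => i _; rewrite !rmorphXn /= fgX.
Qed.

Lemma poly_rmorph_ext (R S : comNzRingType) (f g : {rmorphism {poly R} -> S}) :
  (forall c, f c%:P = g c%:P) -> f 'X = g 'X -> f =1 g.
Proof.
move=> fgC fgX; elim/poly_ind => [|p c IHp]; first by rewrite !rmorph0.
by rewrite !rmorphD !rmorphM /= IHp fgX fgC.
Qed.

(** As a composite of ring morphisms it inherits their structure; [eval2_unique] then reduces
    identities between evaluations to constants and the two variables. *)
Definition eval2 (R S : comNzRingType) (h : {rmorphism R -> S}) (x y : S) :
    {poly {poly R}} -> S :=
  horner_eval y \o map_poly (horner_eval x \o map_poly h).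
HB.instance Definition _ R S h x y :=
  GRing.RMorphism.copy (@eval2 R S h x y) (horner_eval y \o map_poly (horner_eval x \o map_poly h)).

Section Eval2.
Variables (R S : comNzRingType) (h : {rmorphism R -> S}) (x y : S).

Lemma eval2C c : eval2 h x y c%:P%:P = h c.
Proof. by rewrite /eval2 /= map_polyC /= map_polyC /= /horner_eval !hornerC. Qed.

Lemma eval2X : eval2 h x y 'X%:P = x.
Proof. by rewrite /eval2 /= map_polyC /= map_polyX /horner_eval hornerC hornerX. Qed.

Lemma eval2Y : eval2 h x y 'X = y.
Proof. by rewrite /eval2 /= map_polyX /horner_eval hornerX. Qed.

Lemma eval2B p q : eval2 h x y (p - q) = eval2 h x y p - eval2 h x y q.
Proof. by rewrite /eval2 /= !rmorphB. Qed.

Lemma eval2M p q : eval2 h x y (p * q) = eval2 h x y p * eval2 h x y q.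
Proof. by rewrite /eval2 /= !rmorphM. Qed.

Lemma eval2_unique (f : {rmorphism {poly {poly R}} -> S}) :
  (forall c, f c%:P%:P = h c) -> f 'X%:P = x -> f 'X = y -> f =1 eval2 h x y.
Proof.
move=> fC fX fY; apply: poly_rmorph_ext => [p|]; last by rewrite fY; apply/esym/eval2Y.
apply: (poly_rmorph_ext (f := f \o polyC) (g := eval2 h x y \o polyC)) => [c|] /=.
  by rewrite fC eval2C.
by rewrite fX eval2X.
Qed.

End Eval2.

Lemma horner2E (R : comNzRingType) (p : {poly {poly R}}) x y :
  p.[y%:P].[x] = eval2 idfun x y p.
Proof.
rewrite -[LHS]/((horner_eval x \o horner_eval y%:P) p).
by apply: eval2_unique => [c||] /=; rewrite /horner_eval !hornerE.
Qed.

Lemma ord2_neq0 (i : 'I_2) : i <> 0 -> i = 1.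
Proof. by case: i => -[|[|//]] i i0; [case: i0|]; apply: val_inj. Qed.

(* [shear l] expresses a polynomial in the coordinates x' = x + l y, y' = y. *)
Section Shear.
Variables (R : comNzRingType) (l : R).

Definition shear_var (i : 'I_2) : {poly {poly R}} :=
  if i == 0 then 'X%:P - l%:P%:P * 'X else 'X.

Definition shear : {mpoly R[2]} -> {poly {poly R}} := mmap (polyC \o polyC) shear_var.
HB.instance Definition _ := GRing.RMorphism.copy shear (mmap (polyC \o polyC) shear_var).

Definition unshear : {poly {poly R}} -> {mpoly R[2]} :=
  eval2 (mpolyC 2 (R := R)) ('X_0 + l%:MP * 'X_1) 'X_1.
HB.instance Definition _ := GRing.RMorphism.copy unshear
  (eval2 (mpolyC 2 (R := R)) ('X_0 + l%:MP * 'X_1) 'X_1).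

Lemma shearC c : shear c%:MP = c%:P%:P.
Proof. by rewrite /shear mmapC. Qed.

Lemma shearX i : shear 'X_i = shear_var i.
Proof. by rewrite /shear mmapX mmap1U. Qed.

Lemma shearK : cancel shear unshear.
Proof.
apply: (mpoly_rmorph_ext (f := unshear \o shear) (g := idfun)) => [c|i] /=.
  by rewrite shearC /unshear eval2C.
rewrite shearX /shear_var /unshear; case: eqP => [->|i0].
  by rewrite eval2B eval2M eval2C eval2X eval2Y; ring.
by rewrite eval2Y (ord2_neq0 i0).
Qed.

Lemma unshearK : cancel unshear shear.
Proof.
move=> p; pose c : {rmorphism R -> {poly {poly R}}} := polyC \o polyC.
apply: (etrans (y := eval2 c 'X%:P 'X p)).
  apply: (eval2_unique (f := shear \o unshear)) => [a||] /=.
  - by rewrite /unshear eval2C shearC.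
  - by rewrite /unshear eval2X rmorphD rmorphM /= !shearX shearC /shear_var /=; ring.
  - by rewrite /unshear eval2Y shearX.
apply: esym; exact: (eval2_unique (h := c) (f := idfun) (fun _ => erefl) erefl erefl p).
Qed.

Lemma eval2_shear (S : comNzRingType) (h : {rmorphism R -> S}) (z : 'I_2 -> S) p :
  eval2 h (z 0 + h l * z 1) (z 1) (shear p) = (map_mpoly h p).@[z].
Proof.
apply: (mpoly_rmorph_ext (f := eval2 h (z 0 + h l * z 1) (z 1) \o shear)
  (g := meval z \o map_mpoly h)) => [c|i] /=.
  by rewrite shearC eval2C map_mpolyC mevalC.
rewrite shearX map_mpolyX mevalXU /shear_var; case: eqP => [->|i0].
  by rewrite eval2B eval2M eval2C eval2X eval2Y; ring.
by rewrite eval2Y (ord2_neq0 i0).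
Qed.

End Shear.

(** * The local ring at the origin *)

(** Coordinates chosen pointwise give the bijection required by [has_length_dim]; their uniqueness
    makes the choice additive and [k]-linear. *)
Lemma has_length_basis (k : fieldType) (A : comNzRingType) (M : lmodType A) m
    (iota : {rmorphism k -> A}) (t0 t1 : A) (b : 'I_m -> M) :
    (forall f, exists c f0 f1, f = iota c + t0 * f0 + t1 * f1) ->
    (forall c f0 f1, c != 0 -> exists g, g * (iota c + t0 * f0 + t1 * f1) = 1) ->
    (forall v, exists c, v = \sum_i iota (c i) *: b i) ->
    (forall c, \sum_i iota (c i) *: b i = 0 -> forall i, c i = 0) ->
  has_length M m.
Proof.
move=> decomp inv span free.
have /choice[phi phiE] (v : M) : exists u : 'rV[k]_m, v = \sum_i iota (u 0 i) *: b i.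
  have [c ->] := span v; exists (\row_i c i).
  by apply: eq_bigr => i _; rewrite mxE.
have phi_uniq (u : 'rV[k]_m) (v : M) : v = \sum_i iota (u 0 i) *: b i -> phi v = u.
  move=> vE; apply/rowP=> i; apply/eqP; rewrite -subr_eq0; apply/eqP.
  apply: (free (fun i => phi v 0 i - u 0 i));
    transitivity (\sum_i iota (phi v 0 i) *: b i - \sum_i iota (u 0 i) *: b i).
  2: by rewrite -phiE -vE subrr.
  by rewrite -sumrB; apply: eq_bigr => j _; rewrite rmorphB scalerBl.
have phiB : zmod_morphism phi.
  move=> x y; apply: phi_uniq; rewrite {1}(phiE x) {1}(phiE y) -sumrB.
  by apply: eq_bigr => i _; rewrite !mxE rmorphB scalerBl.
pose phiM := GRing.isZmodMorphism.Build M 'rV[k]_m phi phiB.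
pose Phi : {additive M -> 'rV[k]_m} := HB.pack phi phiM.
apply: (has_length_dim (phi := Phi) decomp inv) => /=.
- move=> c v; apply: phi_uniq; rewrite {1}(phiE v) scaler_sumr.
  by apply: eq_bigr => i _; rewrite scalerA !mxE rmorphM.
- by move=> v phi0; rewrite (phiE v) phi0 big1 // => i _; rewrite mxE rmorph0 scale0r.
- by move=> u; exists (\sum_i iota (u 0 i) *: b i); apply: phi_uniq.
Qed.

Lemma tofrac_injective (R : idomainType) : injective (@FracField.tofrac R).
Proof. by move=> x y /eqP; rewrite tofrac_eq => /eqP. Qed.

Lemma mpoly2_decomp (R : comNzRingType) (p : {mpoly R[2]}) :
  exists c a b, p = c%:MP + 'X_0 * a + 'X_1 * b.
Proof.
elim/mpolyind: p => [|c m p _ _ [c0 [a [b ->]]]].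
  by exists 0, 0, 0; rewrite !mulr0 mpolyC0 !addr0.
have [d [a' [b' ->]]] : exists d a' b', 'X_[m] = d%:MP + 'X_0 * a' + 'X_1 * b' :> {mpoly R[2]}.
  rewrite mpolyXE_id big_ord_recl big_ord1.
  have -> : ord0 = 0 :> 'I_2 by apply: val_inj.
  have -> : lift 0 0 = 1 :> 'I_2 by apply: val_inj.
  case: (m 0) => [|n0]; last by exists 0, ('X_0 ^+ n0 * 'X_1 ^+ m 1), 0; rewrite mpolyC0 exprS;
    ring.
  case: (m 1) => [|n1]; last by exists 0, 0, ('X_1 ^+ n1); rewrite mpolyC0 exprS; ring.
  by exists 1, 0, 0; rewrite mpolyC1; ring.
exists (c * d + c0), (c%:MP * a' + a), (c%:MP * b' + b).
by rewrite -mul_mpolyC mpolyCD mpolyCM; ring.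
Qed.

Section FractionIdentities.
Variables (R : comNzRingType) (u v q r : R).
Hypotheses (uq : u * q = 1) (vr : v * r = 1).

Lemma clear_denominators a b x y :
  q * r * (u * a * x + v * b * y) = a * r * x + b * q * y.
Proof.
transitivity ((u * q) * (a * r * x) + (v * r) * (b * q * y)); first by ring.
by rewrite uq vr !mul1r.
Qed.

Lemma fraction_decomp d x y a b :
  u * (d * q + (x * a + y * b)) = d + x * (u * a) + y * (u * b).
Proof.
transitivity ((u * q) * d + x * (u * a) + y * (u * b)); first by ring.
by rewrite uq mul1r.
Qed.

Lemma fraction_sum_inv g c x y a b : g * (c * (q * r) + x * (a * r) + y * (b * q)) = 1 ->
  g * (q * r) * (c + x * (u * a) + y * (v * b)) = 1.
Proof.
move=> <-; transitivity (g * (c * (q * r) + x * (a * r) * (u * q) + y * (b * q) * (v * r))).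
  by ring.
by rewrite uq vr !mulr1.
Qed.

(** Meant for [t = X^m] in the ideal and [a] an inverse of [q] modulo the ideal and [t]: the
    right-hand side lies in the ideal, so the fraction [p / q] is congruent to the polynomial
    [a p]. *)
Lemma fraction_approx p a b t :
  u * p - a * p = u * p * (1 - a * q - b * t) + u * p * b * t.
Proof.
transitivity (u * p - a * p * (u * q)); first by rewrite uq mulr1.
by ring.
Qed.

End FractionIdentities.



Section LocalRingAtOrigin.
Variable L : fieldType.
Local Notation A := (local_ring (0 : 'rV[L]_2)).
Local Notation "p .@0" := (p.@[(0 : 'rV[L]_2) 0]) (at level 2, format "p .@0").
Local Notation loc := (@to_local L 2 0).

Fact to_local_zmod : zmod_morphism loc.
Proof. by move=> p q; apply: val_inj; rewrite /= tofracB. Qed.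
Fact to_local_monoid : monoid_morphism loc.
Proof. by split=> [|p q]; apply: val_inj; rewrite /= ?tofrac1 ?tofracM. Qed.
HB.instance Definition _ := GRing.isZmodMorphism.Build _ _ loc to_local_zmod.
HB.instance Definition _ := GRing.isMonoidMorphism.Build _ _ loc to_local_monoid.

Lemma to_local_unit q : q.@0 != 0 -> exists u : A, u * loc q = 1.
Proof.
move=> q0; have reg : (q%:F)^-1 \in regular_at (0 : 'rV[L]_2).
  by apply/asboolP; exists 1, q; rewrite tofrac1 div1r.
exists (LocalRing reg); apply: val_inj => /=.
by rewrite mulVf //; apply: regular_den q0.
Qed.

Lemma local_fraction (f : A) : exists p q u, [/\ q.@0 != 0, u * loc q = 1 & f = u * loc p].
Proof.
have /asboolP[p [q [q0 fE]]] := lr_valP f.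
have [u uE] := to_local_unit q0; exists p, q, u; split=> //.
rewrite -[f]mul1r -uE -mulrA; congr (_ * _); apply: val_inj => /=.
by rewrite fE mulrC divfK //; apply: regular_den q0.
Qed.

(** Clearing the denominators of the two cofactors brings the relation back to polynomials, at the
    price of a factor not vanishing at the origin. *)
Lemma local_ideal (p1 p2 w : {mpoly L[2]}) : loc w \in ideal2 (loc p1) (loc p2) ->
  exists2 q, q.@0 != 0 & q * w \in ideal2 p1 p2.
Proof.
case/ideal2P=> f [g wE].
have [a [q [u [q0 uE fE]]]] := local_fraction f.
have [b [r [v [r0 vE gE]]]] := local_fraction g.
exists (q * r); first by rewrite mevalM mulf_neq0.
apply/ideal2P; exists (a * r), (b * q).
apply: tofrac_injective; apply: (congr1 val (x := loc _) (y := loc _)).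
rewrite !rmorphD !rmorphM /= wE fE gE.
exact: clear_denominators.
Qed.

Lemma local_ring_decomp (f : A) : exists c f0 f1,
  f = loc c%:MP + loc 'X_0 * f0 + loc 'X_1 * f1.
Proof.
have [p [q [u [q0 uE ->]]]] := local_fraction f.
have [c [a [b E]]] := mpoly2_decomp (p - (p.@0 / q.@0) *: q).
have c0 : c = 0.
  have := congr1 (meval ((0 : 'rV[L]_2) 0)) E.
  rewrite !rmorphD !rmorphM rmorphN /= mevalZ mevalC !mevalXU !mxE divfK // subrr.
  by rewrite !mul0r !addr0.
move: (p.@0 / q.@0) E => d E; exists d, (u * loc a), (u * loc b).
have -> : p = d%:MP * q + ('X_0 * a + 'X_1 * b).
  by move: E; rewrite c0 mpolyC0 add0r -mul_mpolyC => <-; ring.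
rewrite !(rmorphD, rmorphM) /=; exact: fraction_decomp.
Qed.

Lemma local_ring_inv c (f0 f1 : A) : c != 0 ->
  exists g, g * (loc c%:MP + loc 'X_0 * f0 + loc 'X_1 * f1) = 1.
Proof.
move=> c0.
have [a [q [u [q0 uE ->]]]] := local_fraction f0.
have [b [r [v [r0 vE ->]]]] := local_fraction f1.
have [|g gE] := @to_local_unit (c%:MP * (q * r) + 'X_0 * (a * r) + 'X_1 * (b * q)).
  rewrite !(mevalD, mevalM) mevalC !mevalXU !mxE !mul0r !addr0.
  by rewrite !mulf_neq0.
exists (g * (loc q * loc r)).
by apply: (fraction_sum_inv uE vE); rewrite -gE !(rmorphD, rmorphM).
Qed.

End LocalRingAtOrigin.

Section LengthAtOrigin.
Variable L : fieldType.
Hypothesis rootL : forall p : {poly L}, (1 < size p)%N -> exists x, root p x.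
Variables (p1 p2 : {mpoly L[2]}) (l : L) (m : nat) (s : {poly L}).
Local Notation P := (shear l p1).
Local Notation Q := (shear l p2).
Local Notation X := ('X - 0%:P : {poly L}).
Hypotheses (P1 : (1 < size P)%N) (Q1 : (1 < size Q)%N).
Hypothesis Qlead : lead_coef Q \is a GRing.unit.
Hypothesis resE : resultant P Q = X ^+ m * s.
Hypothesis s0 : ~~ root s 0.
Hypothesis uniq0 : forall y, P.[y%:P].[0] = 0 -> Q.[y%:P].[0] = 0 -> y = 0.

Local Notation A := (local_ring (0 : 'rV[L]_2)).
Local Notation "p .@0" := (p.@[(0 : 'rV[L]_2) 0]) (at level 2, format "p .@0").
Local Notation loc := (@to_local L 2 0).
Local Notation tau := (loc \o @unshear L l).
Local Notation IB := (ideal2 P Q).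
Local Notation IA := (ideal2 (loc p1) (loc p2)).
Local Open Scope quotient_scope.
Local Notation "'pi' f" := (\pi_(quot2 (loc p1) (loc p2)) f) (at level 10, f at level 9).

Lemma shear_at_origin p : (shear l p).[0%:P].[0] = p.@0.
Proof.
rewrite horner2E; have := eval2_shear l idfun ((0 : 'rV[L]_2) 0) p.
rewrite !mxE mulr0 addr0 => ->; congr meval.
apply: (mpoly_rmorph_ext (f := map_mpoly idfun) (g := idfun)) => [c|i] /=.
  by rewrite map_mpolyC.
by rewrite map_mpolyX.
Qed.

Lemma unshear_at_origin w : (unshear l w).@0 = w.[0%:P].[0].
Proof. by rewrite -shear_at_origin unshearK. Qed.

Lemma tau_ideal w : w \in IB -> tau w \in IA.
Proof.
case/ideal2P=> a [b ->]; apply/ideal2P; exists (tau a), (tau b).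
by rewrite /= !(rmorphD, rmorphM) /= !shearK.
Qed.

(** Among polynomials only [X^m s], the resultant, is known to lie in the ideal; [s] becomes a unit
    in the local ring because it does not vanish at 0. *)
Lemma tau_Xm : tau (X%:P ^+ m) \in IA.
Proof.
have [|u uE] := @to_local_unit L (unshear l s%:P).
  by rewrite unshear_at_origin hornerC.
have R : tau ((resultant P Q)%:P) \in IA by apply/tau_ideal/resultant_ideal2.
have -> : tau (X%:P ^+ m) = u * tau (resultant P Q)%:P; last exact: ideal2M.
rewrite resE /= !rmorphM !rmorphXn /=.
by rewrite mulrCA [u * _]uE mulr1.
Qed.

(** The images of the torsion basis form a basis of the local quotient. Spanning: [local_unit]
    replaces a fraction by a polynomial, which an idempotent moves into the torsion part. Freeness:
    a relation becomes polynomial after multiplication by some [q] not vanishing at the origin, and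
    [q] is invertible on the torsion part. *)
Lemma length_at_origin : intersection_multiplicity p1 p2 0 m.
Proof.
have [g [g_free g_span g_tors]] := bivariate_torsion_basis P1 Q1 Qlead resE s0.
have piE (f h : A) : (pi f == pi h) = (f - h \in IA).
  by rewrite -Quotient.idealrBE.
have [T [T_shear T_unshear T_ideal T_Xm TC]] : exists T : {rmorphism {poly {poly L}} -> A},
    [/\ forall p, T (shear l p) = loc p, forall w, T w = loc (unshear l w),
        forall w, w \in IB -> T w \in IA, T (X%:P ^+ m) \in IA
      & forall c, T c%:P%:P = loc c%:MP].
  exists tau; split=> //=; [by move=> p; rewrite shearK | exact: tau_ideal | exact: tau_Xm |].
  by move=> c; rewrite /unshear eval2C.
have tau_sum (c : 'I_m -> L) :
    \sum_i loc (c i)%:MP *: pi (T (g i))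
    = pi (T (\sum_i (c i)%:P%:P * g i)).
  rewrite rmorph_sum raddf_sum; apply: eq_bigr => i _.
  rewrite [LHS]quot2_scale_pi; congr (pi _).
  by rewrite rmorphM TC.
apply: (@has_length_basis L A _ m (loc \o mpolyC 2 (R := L)) (loc 'X_0) (loc 'X_1)
  (fun i => pi (T (g i)))).
- exact: local_ring_decomp.
- exact: local_ring_inv.
- move=> v; rewrite -[v]reprK; move: (repr v) => f {v}.
  have [p [q [u [q0 uE ->]]]] := local_fraction f.
  have [|a [b abI]] := local_unit rootL (unit_lead_horner_neq0 0 Qlead) uniq0 m (u := shear l q).
    by rewrite shear_at_origin.
  have /Bezout_eq1_coprimepP[[al be] /= ab1] : coprimep (X ^+ m) s.
    by rewrite coprimep_expl // coprimep_sym coprimep_XsubC.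
  pose w := a * shear l p.
  (* As [al X^m + be s = 1] and [X^m] lies in the local ideal, [be s] acts as 1 on the local
     quotient, while [X^m be s] is a multiple of the resultant. *)
  have [|c cI] := g_span ((be * s)%:P * w) m.
    have -> : X%:P ^+ m * ((be * s)%:P * w) = be%:P * w * (resultant P Q)%:P.
      by rewrite resE !rmorphM rmorphXn /=; ring.
    exact: ideal2M (resultant_ideal2 P1 Q1).
  exists c; rewrite tau_sum; apply/eqP; rewrite piE.
  set S := \sum_i _ in cI *.
  have fw : u * loc p - T w \in IA.
    rewrite /w rmorphM T_shear (fraction_approx uE _ _ (T b) (T (X%:P ^+ m))).
    have -> : 1 - T a * loc q - T b * T (X%:P ^+ m) = T (1 - a * shear l q - b * X%:P ^+ m).
      by rewrite (rmorphB T) (rmorphB T) (rmorphM T) (rmorphM T) rmorph1 T_shear.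
    by apply: rpredD; apply: ideal2M; [apply: T_ideal|apply: T_Xm].
  have wS : T w - T S \in IA.
    have -> : T w - T S = T (al%:P * w) * T (X%:P ^+ m) + T ((be * s)%:P * w - S).
      rewrite -rmorphM -rmorphD -rmorphB; congr (T _).
      rewrite -[w in LHS]mul1r -polyC1 -ab1 rmorphD !rmorphM rmorphXn /=; ring.
    by apply: rpredD; [apply: ideal2M; apply: T_Xm|apply: T_ideal].
  by rewrite -[u * _](subrK (T w)) -addrA; apply: rpredD.
- move=> c; rewrite tau_sum => /eqP.
  rewrite -(raddf0 \pi_(quot2 (loc p1) (loc p2))) piE subr0 T_unshear => /local_ideal[q q0 qI].
  apply: g_free; set S := \sum_i _ in qI *.
  have SI : shear l q * S \in IB.
    have /ideal2P[a [b abE]] := qI; apply/ideal2P; exists (shear l a), (shear l b).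
    by rewrite -!rmorphM -rmorphD -abE rmorphM /= unshearK.
  have XS : X%:P ^+ m * S \in IB.
    rewrite mulr_sumr rpred_sum // => i _; rewrite mulrCA; exact: ideal2M.
  have [|a [b abI]] := local_unit rootL (unit_lead_horner_neq0 0 Qlead) uniq0 m (u := shear l q).
    by rewrite shear_at_origin.
  rewrite (_ : S = S * (1 - a * shear l q - b * X%:P ^+ m) + (a * (shear l q * S) + b * (X%:P ^+
    m * S))); last by ring.
  by apply: rpredD; [|apply: rpredD]; apply: ideal2M.
Qed.
End LengthAtOrigin.

(** * Residues in the tower of Laurent series fields *)

Section ValuationRing.
Import Order.TTheory Num.Theory.
Variables (F : fieldType) (v : F -> rat).
Hypothesis vP : valuation v.
Local Notation ge0 := (val_ge0 v).
Local Notation gt0 := (val_gt0 v).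

Lemma val1 : v 1 = 0.
Proof. by have := vP.1 1 1 (oner_neq0 _) (oner_neq0 _); rewrite mulr1; lra. Qed.

Lemma valN x : x != 0 -> v (- x) = v x.
Proof.
move=> x0; have N10 : -1 != 0 :> F by rewrite oppr_eq0 oner_eq0.
have := vP.1 (-1) (-1) N10 N10; rewrite mulrNN mulr1 val1 => N1.
by rewrite -mulN1r vP.1 //; lra.
Qed.

Lemma valV x : x != 0 -> v x^-1 = - v x.
Proof. by move=> x0; have := vP.1 x x^-1 x0; rewrite invr_eq0 divff // val1 => /(_ x0); lra. Qed.

Lemma ge0W x : gt0 x -> ge0 x.
Proof. by rewrite /val_gt0 /val_ge0 => /orP[->//|/ltW ->]; rewrite orbT. Qed.

Lemma ge0D x y : ge0 x -> ge0 y -> ge0 (x + y).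
Proof.
rewrite /val_ge0; have [->|x0] /= := eqVneq x 0; first by rewrite add0r.
have [->|y0] /= := eqVneq y 0; first by rewrite addr0 (negPf x0).
have [//|xy0 /=] := eqVneq (x + y) 0 => vx vy.
by apply: le_trans (vP.2 x y x0 y0 xy0); rewrite le_min vx vy.
Qed.

Lemma gt0D x y : gt0 x -> gt0 y -> gt0 (x + y).
Proof.
rewrite /val_gt0; have [->|x0] /= := eqVneq x 0; first by rewrite add0r.
have [->|y0] /= := eqVneq y 0; first by rewrite addr0 (negPf x0).
have [//|xy0 /=] := eqVneq (x + y) 0 => vx vy.
by apply: lt_le_trans (vP.2 x y x0 y0 xy0); rewrite lt_min vx vy.
Qed.

Lemma ge0M x y : ge0 x -> ge0 y -> ge0 (x * y).
Proof.
rewrite /val_ge0 mulf_eq0; have [//|x0] /= := eqVneq x 0.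
by have [//|y0 vx vy] /= := eqVneq y 0; rewrite vP.1 // addr_ge0.
Qed.

Lemma gt0M x y : gt0 x -> ge0 y -> gt0 (x * y).
Proof.
rewrite /val_gt0 /val_ge0 mulf_eq0; have [//|x0] /= := eqVneq x 0.
by have [//|y0 vx vy] /= := eqVneq y 0; rewrite vP.1 // ltr_wpDr.
Qed.

Lemma gt0N x : gt0 x -> gt0 (- x).
Proof. by rewrite /val_gt0 oppr_eq0; have [//|x0 vx] /= := eqVneq x 0; rewrite valN. Qed.

Lemma gt0_1 : gt0 1 = false.
Proof. by rewrite /val_gt0 oner_eq0 val1 ltxx. Qed.

Lemma gt0_0 : gt0 0. Proof. by rewrite /val_gt0 eqxx. Qed.

Lemma ge0_1 : ge0 1. Proof. by rewrite /val_ge0 val1 lexx orbT. Qed.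

Lemma ge0X x n : ge0 x -> ge0 (x ^+ n).
Proof. by move=> x0; elim: n => [|n IHn]; rewrite ?ge0_1 // exprS ge0M. Qed.

Lemma gt0_sum I (r : seq I) (P : pred I) f : (forall i, P i -> gt0 (f i)) -> gt0 (\sum_(i <- r |
  P i) f i).
Proof. by move=> fP; apply: (big_ind gt0) => //; [exact: gt0_0|exact: gt0D]. Qed.

Lemma gt0_prod_XsubC (rs : seq F) x : (forall r, r \in rs -> ge0 (x - r)) ->
  gt0 (\prod_(r <- rs) (x - r)) -> exists2 r, r \in rs & gt0 (x - r).
Proof.
elim: rs => [|r rs IHrs] rs_ge0; first by rewrite big_nil gt0_1.
rewrite big_cons => prod_gt0.
have [xr|xr] := boolP (gt0 (x - r)); first by exists r; rewrite ?mem_head.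
have [||r' rs_r' xr'] := IHrs; last by exists r'; rewrite // inE rs_r' orbT.
  by move=> r' rs_r'; apply: rs_ge0; rewrite inE rs_r' orbT.
have xr0 : x - r != 0 by apply: contraNneq xr => ->; apply: gt0_0.
have vxr : v (x - r) = 0.
  have := rs_ge0 r (mem_head _ _); move: xr; rewrite /val_gt0 /val_ge0 (negPf xr0) /= -leNgt.
  lra.
rewrite -[\prod_(_ <- _) _](mulKf xr0) mulrC; apply: gt0M prod_gt0 _.
by rewrite /val_ge0 valV // vxr oppr0 lexx orbT.
Qed.

End ValuationRing.

(** * Orders of power series and residues of Laurent series *)

Section FpsOrder.
Import Order.TTheory Num.Theory.
Variable k : fieldType.
Implicit Types f g : fps k.

Lemma fpsM_coef f g n : (f * g) n = \sum_(i < n.+1) f i * g (n - i)%N.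
Proof. by []. Qed.

Lemma fps0_coef n : (0 : fps k) n = 0.
Proof. by case: n. Qed.

Lemma fps_order_eq f n : f n != 0 -> (forall i, (i < n)%N -> f i = 0) -> fps_order f = n.
Proof.
move=> fn lt_n; have f0 : f != 0 by apply: contraNneq fn => ->; rewrite fps0_coef.
have [fo lt_o] := fps_orderP f0.
case: (ltngtP (fps_order f) n) => // [/lt_n|/lt_o] f_eq0.
  by rewrite f_eq0 eqxx in fo.
by rewrite f_eq0 eqxx in fn.
Qed.

Lemma fps_order_ge f n : f != 0 -> (forall i, (i < n)%N -> f i = 0) -> (n <= fps_order f)%N.
Proof.
move=> f0 lt_n; have [fo _] := fps_orderP f0.
by rewrite leqNgt; apply/negP => /lt_n f_eq0; rewrite f_eq0 eqxx in fo.
Qed.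

Lemma fps_orderM f g : f != 0 -> g != 0 -> fps_order (f * g) = (fps_order f + fps_order g)%N.
Proof.
move=> f0 g0; have [fm f_lt] := fps_orderP f0; have [gn g_lt] := fps_orderP g0.
apply: fps_order_eq => [|i lt_i].
  have lt_m : (fps_order f < (fps_order f + fps_order g).+1)%N by rewrite ltnS leq_addr.
  rewrite fpsM_coef (bigD1 (Ordinal lt_m)) //= addKn big1 ?addr0 ?mulf_neq0 // => i.
  rewrite -val_eqE /= neq_ltn => /orP[lt_im|lt_mi]; first by rewrite f_lt ?mul0r.
  by rewrite g_lt ?mulr0 //; have := ltn_ord i; lia.
rewrite fpsM_coef big1 // => j _; have [lt_j|le_j] := ltnP j (fps_order f).
  by rewrite f_lt ?mul0r.
by rewrite g_lt ?mulr0 //; have := ltn_ord j; lia.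
Qed.

Lemma fps_const_neq0 (c : k) : c != 0 -> fps_const c != 0.
Proof.
apply: contraNneq => /(congr1 (fun f : fps k => f 0%N)); rewrite fps0_coef => c0.
by apply/eqP.
Qed.

Lemma frac_numden (R : idomainType) (x : {fraction R}) :
  x * (\d_(repr x))%:F = (\n_(repr x))%:F.
Proof.
rewrite -{1}[x]reprK; unlock FracField.tofrac; rewrite -[LHS]FracField.pi_mul.
apply/eqmodP; rewrite /= FracField.equivfE /FracField.mulf !numden_Ratio ?mulr1 ?oner_neq0
  ?denom_ratioP //.
by rewrite mulrC.
Qed.

Lemma frac_div_numden (R : idomainType) (x : {fraction R}) :
  x = (\n_(repr x))%:F / (\d_(repr x))%:F.
Proof. by rewrite -frac_numden mulfK // tofrac_eq0 denom_ratioP. Qed.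

Lemma frac_sub_tofrac (R : idomainType) (n d c : R) : d != 0 ->
  n%:F / d%:F - c%:F = (n - c * d)%:F / d%:F.
Proof. by move=> d0; rewrite tofracB tofracM mulrBl mulfK // tofrac_eq0. Qed.

(** [tadic] reads the representative chosen by [repr]; orders add under products, so
    cross-multiplication shows that any other representative gives the same value. *)
Lemma tadicE f g : f != 0 -> g != 0 ->
  tadic (f%:F / g%:F) = (fps_order f)%:R - (fps_order g)%:R.
Proof.
move=> f0 g0; rewrite /tadic; set x := _ / _; set n := \n_ _; set d := \d_ _.
have d0 : d != 0 by apply: denom_ratioP.
have E : f * d = n * g.
  apply/eqP; rewrite -(tofrac_eq (f * d)) !tofracM -frac_numden -/d /x.
  by rewrite mulrAC divfK // tofrac_eq0.
have n0 : n != 0.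
  by apply: contraNneq f0 => n0; move/eqP: E; rewrite n0 mul0r mulf_eq0 (negPf d0) orbF.
have := congr1 (fun o : nat => o%:R : rat) (congr1 (@fps_order k) E).
by rewrite !fps_orderM // !natrD; lra.
Qed.

Lemma tadic_const (c : k) : c != 0 -> tadic (fps_const c)%:F = 0.
Proof.
move=> c0; rewrite -[_%:F]divr1 -tofrac1 tadicE ?fps_const_neq0 ?oner_neq0 //.
rewrite !(@fps_order_eq _ 0%N) ?subrr //; exact: oner_neq0.
Qed.

Lemma tadic_residue (x : laurent k) : x != 0 -> 0 <= tadic x ->
  exists c : k, (x - (fps_const c)%:F == 0) || (0 < tadic (x - (fps_const c)%:F)).
Proof.
move=> x0; set n := \n_(repr x); set d := \d_(repr x).
have d0 : d != 0 by apply: denom_ratioP.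
have xE : x = n%:F / d%:F := frac_div_numden x.
have n0 : n != 0 by apply: contraNneq x0 => n0; rewrite xE n0 tofrac0 mul0r.
rewrite xE tadicE // subr_ge0 ler_nat => le_dn.
have [d_o d_lt] := fps_orderP d0; have [n_o n_lt] := fps_orderP n0.
(* One formula covers both cases: [n o] is the lowest coefficient of [n] when the orders agree, and
   0 when the valuation is positive. *)
pose o := fps_order d; pose c := n o / d o; exists c.
have -> : n%:F / d%:F - (fps_const c)%:F = (n - fps_const c * d)%:F / d%:F := frac_sub_tofrac _ _
  d0.
have [->|r0] := eqVneq (n - fps_const c * d) 0; first by rewrite tofrac0 mul0r eqxx.
rewrite mulf_eq0 invr_eq0 !tofrac_eq0 (negPf r0) (negPf d0) /= tadicE // subr_gt0 ltr_nat.
apply: fps_order_ge => // i lt_i.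
have cd : (fps_const c * d) i = c * d i.
  rewrite fpsM_coef big_ord_recl subn0 big1 ?addr0 // => j _.
  by rewrite mul0r.
rewrite -[LHS]/(n i - (fps_const c * d) i) cd.
move: lt_i; rewrite ltnS leq_eqVlt => /orP[/eqP ->|lt_i]; last first.
  by rewrite d_lt // n_lt ?mulr0 ?subrr // (leq_trans lt_i).
by rewrite /c divfK ?subrr.
Qed.

End FpsOrder.

Section ClosureResidue.
Import Order.TTheory Num.Theory.
Variables (k : closedFieldType) (E : laurent_closure k).
Local Notation v := (@lc_val k E).
Local Notation vP := (@lc_valuation k E).
Local Notation ge0 := (val_ge0 v).
Local Notation gt0 := (val_gt0 v).

Definition lc_constM : {rmorphism k -> E} :=
  lc_embed E \o @FracField.tofrac (fps k) \o @fps_const k.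

Lemma lc_constE c : lc_constM c = lc_const E c. Proof. by []. Qed.

Lemma val_const (c : k) : c != 0 -> v (lc_constM c) = 0.
Proof.
move=> c0; rewrite lc_constE /lc_const lc_val_embed ?tadic_const //.
by rewrite tofrac_eq0 fps_const_neq0.
Qed.

Lemma ge0_const c : ge0 (lc_constM c).
Proof.
rewrite /val_ge0; have [->|c0] := eqVneq c 0; first by rewrite rmorph0 eqxx.
by rewrite val_const // lexx orbT.
Qed.

Lemma gt0_const c : gt0 (lc_constM c) -> c = 0.
Proof.
rewrite /val_gt0 fmorph_eq0; have [//|c0] /= := eqVneq c 0.
by rewrite val_const // ltxx.
Qed.

Lemma has_residue_const (c : k) : has_residue (lc_constM c) c.
Proof. by rewrite /has_residue -lc_constE subrr gt0_0. Qed.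

Lemma has_residue_ge0 (x : E) c : has_residue x c -> ge0 x.
Proof.
rewrite /has_residue => /ge0W xc; rewrite -[x](subrK (lc_const E c)).
exact: (ge0D vP xc (ge0_const c)).
Qed.

Lemma has_residueB (x y : E) c d : has_residue x c -> has_residue y d ->
  has_residue (x - y) (c - d).
Proof.
rewrite /has_residue -!lc_constE rmorphB => xc yd.
have -> : x - y - (lc_constM c - lc_constM d) = (x - lc_constM c) + - (y - lc_constM d) by ring.
by apply: (gt0D vP) => //; apply: (gt0N vP).
Qed.

Lemma has_residueM (x y : E) c d : has_residue x c -> has_residue y d ->
  has_residue (x * y) (c * d).
Proof.
move=> xc yd; have yge0 := has_residue_ge0 yd; move: xc yd.
rewrite /has_residue -!lc_constE rmorphM => xc yd.
have -> : x * y - (lc_constM c * lc_constM d)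
  = (x - lc_constM c) * y + (y - lc_constM d) * lc_constM c by ring.
by apply: (gt0D vP); apply: (gt0M vP) => //; apply: ge0_const.
Qed.

Lemma has_residue_uniq (x : E) c d : has_residue x c -> has_residue x d -> c = d.
Proof.
move=> xc xd; have := has_residueB xc xd.
rewrite subrr /has_residue sub0r -lc_constE => /(gt0N vP); rewrite opprK => /gt0_const/eqP.
by rewrite subr_eq0 => /eqP.
Qed.

Lemma embed_residue (x : laurent k) : ge0 (lc_embed E x) ->
  exists c, has_residue (lc_embed E x) c.
Proof.
have [->|x0] := eqVneq x 0.
  by exists 0; rewrite /has_residue rmorph0 -lc_constE rmorph0 subrr gt0_0.
rewrite /val_ge0 fmorph_eq0 (negPf x0) /= lc_val_embed // => /(tadic_residue x0)[c xc].
exists c; rewrite /has_residue /lc_const -rmorphB /val_gt0 fmorph_eq0.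
move: xc; have [//|xc0 /=] := eqVneq (x - _) 0.
by rewrite lc_val_embed.
Qed.

(* Normalise an algebraic equation of [x] so that its coefficients have
   valuation >= 0 and one of them is 1; its reduction splits over [k]. *)
Lemma residue_exists (x : E) : ge0 x -> exists c, has_residue x c.
Proof.
move=> xge0; have [p p0 px] := lc_algebraic x.
pose e i := lc_embed E p`_i.
have [i0 pi0] : exists i : 'I_(size p), p`_i != 0.
  have sp : ((size p).-1 < size p)%N by rewrite prednK // size_poly_gt0.
  by exists (Ordinal sp); rewrite /= -lead_coefE lead_coef_eq0.
pose j := [arg min_(i < i0 | p`_i != 0) v (e i)]%O.
have [pj jmin] : p`_j != 0 /\ forall i : 'I_(size p), p`_i != 0 -> v (e j) <= v (e i).
  by rewrite /j; case: arg_minP.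
have ej0 : e j != 0 by rewrite fmorph_eq0.
have /choice[c cP] (i : nat) : exists c : k, has_residue (e i / e j) c.
  rewrite /e -fmorph_div; apply: embed_residue; rewrite fmorph_div /val_ge0.
  have [->|pi] := eqVneq p`_i 0; first by rewrite rmorph0 mul0r eqxx.
  have lt_i : (i < size p)%N by rewrite ltnNge; apply: contraNN pi => /(nth_default 0) ->.
  have ei : e i != 0 by rewrite fmorph_eq0.
  rewrite vP.1 ?invr_eq0 // (valV vP) // subr_ge0.
  by rewrite (jmin (Ordinal lt_i)) // orbT.
pose q := \poly_(i < size p) c i.
have cj : c j = 1.
  have ejj := cP j; rewrite divff // in ejj.
  by apply: has_residue_uniq ejj _; have := has_residue_const 1; rewrite rmorph1.
have q0 : q != 0.
  apply: contraTneq (oner_neq0 k) => /polyP/(_ j); rewrite coef_poly ltn_ord coef0 cj => ->.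
  by rewrite eqxx.
have qx : gt0 (map_poly lc_constM q).[x].
  have sq : (size (map_poly lc_constM q) <= size p)%N by rewrite size_map_poly size_poly.
  rewrite (horner_coef_wide _ sq).
  have px' : \sum_(i < size p) e i / e j * x ^+ i = 0.
    have := px; rewrite rootE horner_coef size_map_poly => /eqP px0.
    transitivity ((e j)^-1 * \sum_(i < size p) e i * x ^+ i).
      by rewrite mulr_sumr; apply: eq_bigr => i _; rewrite mulrA [_ / e j]mulrC.
    apply/eqP; rewrite mulf_eq0; apply/orP; right; apply/eqP; rewrite -[RHS]px0.
    by apply: eq_bigr => i _; rewrite coef_map.
  rewrite -[X in gt0 X]subr0 -[X in _ - X]px' -sumrB.
  apply: (gt0_sum vP) => i _; rewrite coef_map coef_poly ltn_ord -mulrBl.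
  apply: (gt0M vP); last exact: (ge0X vP).
  by rewrite -opprB; apply: (gt0N vP); apply: cP.
have [rs qE] := closed_field_poly_normal q.
have lq0 : lead_coef q != 0 by rewrite lead_coef_eq0.
have prod_gt0 : gt0 (\prod_(r <- [seq lc_constM r | r <- rs]) (x - r)).
  have clq0 : lc_constM (lead_coef q) != 0 by rewrite fmorph_eq0.
  rewrite big_map -[X in gt0 X](mulKf clq0) mulrC; apply: (gt0M vP); last first.
    by rewrite /val_ge0 (valV vP) // val_const // oppr0 lexx orbT.
  move: qx; rewrite [in (map_poly _ q)]qE map_polyZ hornerZ rmorph_prod horner_prod.
  by congr (is_true (gt0 (_ * _))); apply: eq_bigr => r _; rewrite /= map_polyXsubC !hornerE.
have [|r /mapP[a _ ->] xa] := gt0_prod_XsubC vP _ prod_gt0.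
  move=> r /mapP[a _ ->]; rewrite -[- _]/(- lc_constM a) -rmorphN.
  exact: (ge0D vP xge0 (ge0_const _)).
by exists a.
Qed.

End ClosureResidue.

Lemma has_residue0 (k : closedFieldType) (E : laurent_closure k) (x : E) :
  has_residue x 0 = val_gt0 (@lc_val k E) x.
Proof. by rewrite /has_residue -lc_constE rmorph0 subr0. Qed.

Lemma affine_to_proj_l (F : fieldType) n (x : 'rV[F]_n) :
  affine_to_proj x 0 (lshift n (0 : 'I_1)) = 1.
Proof. by apply: etrans (@row_mxEl F 1 1 n _ _ 0 0) _; rewrite mxE eqxx. Qed.

Lemma affine_to_proj_r (F : fieldType) n (x : 'rV[F]_n) j :
  affine_to_proj x 0 (rshift 1 j) = x 0 j.
Proof. exact: (@row_mxEr F 1 1 n). Qed.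

(** * The composite place of the tower and the infinitesimal neighbourhoods *)

Section TowerResidue.
Import Order.TTheory Num.Theory.
Variable closure : forall k : closedFieldType, laurent_closure k.
Variable L : closedFieldType.
Local Notation tow := (tower closure L).

(** Affine counterpart of [Pi_tower], kept as a relation because an element that is infinite at some
    stage has no residue in [L]. *)
Fixpoint tower_residue (N : nat) : tow N -> L -> Prop :=
  match N return tow N -> L -> Prop with
  | 0 => fun x a => x = a
  | N'.+1 => fun x a => exists2 y : tow N',
      @has_residue (tow N') (closure (tow N')) x y & tower_residue y a
  end.

Lemma tower_residueB N (x y : tow N) a b :
  tower_residue x a -> tower_residue y b -> tower_residue (x - y) (a - b).
Proof.
elim: N x y a b => [|N IHN] x y a b /=; first by move=> -> ->.
move=> [x' xx' x'a] [y' yy' y'b]; exists (x' - y'); last exact: IHN.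
exact: has_residueB.
Qed.

Lemma tower_residueM N (x y : tow N) a b :
  tower_residue x a -> tower_residue y b -> tower_residue (x * y) (a * b).
Proof.
elim: N x y a b => [|N IHN] x y a b /=; first by move=> -> ->.
move=> [x' xx' x'a] [y' yy' y'b]; exists (x' * y'); last exact: IHN.
exact: has_residueM.
Qed.

Lemma tower_residue_uniq N (x : tow N) a b :
  tower_residue x a -> tower_residue x b -> a = b.
Proof.
elim: N x a b => [|N IHN] x a b /=; first by move=> -> ->.
move=> [y xy ya] [y' xy' yb]; apply: IHN ya _.
by rewrite (has_residue_uniq xy xy').
Qed.

Lemma tower_residue_incl N (x : tow N) a :
  tower_residue x a -> @tower_residue N.+1 (tower_incl x) a.
Proof. by move=> xa; exists x => //; apply: has_residue_const. Qed.

(** A composite of places is a place. If [x] has a residue [y] that is infinite further down, then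
    [y] is nonzero and [x^-1] has residue [y^-1], which goes to 0. If [x] is not integral, [x^-1]
    has residue 0 already at the top stage. *)
Lemma tower_residue_total N (x : tow N) :
  (exists a, tower_residue x a) \/ (x != 0 /\ tower_residue x^-1 0).
Proof.
elim: N x => [|N IHN] x; first by left; exists x.
have [/residue_exists[y xy]|] := boolP (val_ge0 (@lc_val _ (closure (tow N))) x).
  have [[a ya]|[y0 yV]] := IHN y; first by left; exists a, y.
  have x0 : x != 0.
    apply: contraNneq y0 => x0; rewrite x0 in xy; apply/eqP/(has_residue_uniq xy).
    by have := @has_residue_const (tow N) (closure (tow N)) 0; rewrite rmorph0.
  right; split=> //; exists y^-1 => //.
  have : (val_ge0 (@lc_val _ (closure (tow N))) x^-1).
    have vx0 : lc_val x = 0.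
      have := has_residue_ge0 xy; rewrite /val_ge0 (negPf x0) /= le_eqVlt eq_sym.
      case/orP=> [/eqP //|x_gt0]; case/eqP: y0; apply: has_residue_uniq xy _.
      by rewrite has_residue0 /val_gt0 x_gt0 orbT.
    by rewrite /val_ge0 (valV (@lc_valuation _ _)) // vx0 oppr0 lexx orbT.
  move=> /residue_exists[z xz]; suff -> : y^-1 = z by [].
  apply: (mulfI y0); rewrite divff //; apply: has_residue_uniq (has_residueM xy xz).
  by rewrite divff //; have := @has_residue_const (tow N) (closure (tow N)) 1; rewrite rmorph1.
rewrite /val_ge0 negb_or -ltNge => /andP[x0 xlt0]; right; split=> //.
exists 0; last first.
  elim: N {IHN x x0 xlt0} => [//|N IHN]; exists 0 => //.
  by have := @has_residue_const (tow N) (closure (tow N)) 0; rewrite rmorph0.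
rewrite has_residue0 /val_gt0 (valV (@lc_valuation _ _)) //.
by rewrite oppr_gt0 xlt0 orbT.
Qed.

Variable K : tower_union closure L.

Definition union_residue (z : K) (a : L) := exists N (x : tow N), z = tu_in K N x /\
  tower_residue x a.

Lemma tu_lift N M (x : tow N) : (N <= M)%N ->
  exists x' : tow M, tu_in K N x = tu_in K M x' /\ forall a, tower_residue x a -> tower_residue
    x' a.
Proof.
elim: M => [|M IHM]; first by case: N x => // x _; exists x.
rewrite leq_eqVlt => /orP[/eqP NM|]; first by subst N; exists x.
move=> /IHM[y [yE ya]]; exists (tower_incl y); rewrite tu_compat; split=> // a /ya.
exact: tower_residue_incl.
Qed.

Lemma union_residue_lift z a : union_residue z a ->
  exists N, forall M, (N <= M)%N -> exists x : tow M, z = tu_in K M x /\ tower_residue x a.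
Proof.
move=> [N [x [-> xa]]]; exists N => M /(@tu_lift _ _ x)[x' [xE x'a]].
by exists x'; split=> //; apply: x'a.
Qed.

Lemma union_residue_lift2 z w a b : union_residue z a -> union_residue w b -> exists N (x y : tow
  N),
  [/\ z = tu_in K N x, w = tu_in K N y, tower_residue x a & tower_residue y b].
Proof.
move=> /union_residue_lift[N zN] /union_residue_lift[M wM]; exists (maxn N M).
have [x [zE xa]] := zN _ (leq_maxl N M); have [y [wE yb]] := wM _ (leq_maxr N M).
by exists x, y.
Qed.

Lemma union_residue_uniq z a b : union_residue z a -> union_residue z b -> a = b.
Proof.
move=> za zb; have [N [x [y [zx zy xa yb]]]] := union_residue_lift2 za zb.
have xy : x = y by apply: (fmorph_inj (tu_in K N)); rewrite -zx.
by apply: tower_residue_uniq xa _; rewrite xy.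
Qed.

Lemma union_residueB z w a b : union_residue z a -> union_residue w b -> union_residue (z - w) (a
  - b).
Proof.
move=> za wb; have [N [x [y [-> -> xa yb]]]] := union_residue_lift2 za wb.
by exists N, (x - y); rewrite rmorphB; split=> //; apply: tower_residueB.
Qed.

Lemma union_residueM z w a b : union_residue z a -> union_residue w b -> union_residue (z * w) (a
  * b).
Proof.
move=> za wb; have [N [x [y [-> -> xa yb]]]] := union_residue_lift2 za wb.
by exists N, (x * y); rewrite rmorphM; split=> //; apply: tower_residueM.
Qed.

Lemma union_residue_base c : union_residue (base_incl K c) c.
Proof. by exists 0, c. Qed.

Lemma union_residue_total z : (exists a, union_residue z a) \/ (z != 0 /\ union_residue z^-1 0).
Proof.
have [N [x ->]] := tu_exhaust z.
have [[a xa]|[x0 xV]] := tower_residue_total x; first by left; exists a, N, x.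
by right; rewrite fmorph_eq0; split=> //; exists N, x^-1; rewrite fmorphV.
Qed.

Lemma poly_from_tower (p : {poly K}) : exists N (q : {poly tow N}), p = map_poly (tu_in K N) q.
Proof.
elim/poly_ind: p => [|p c [N [q ->]]]; first by exists 0, 0; rewrite rmorph0.
have [M [x ->]] := tu_exhaust c.
have [x' [-> _]] := tu_lift x (leq_maxr N M).
have /choice[f fP] (y : tow N) : exists y' : tow (maxn N M), tu_in K N y = tu_in K (maxn N M) y'.
  by have [y' [yE _]] := tu_lift y (leq_maxl N M); exists y'.
have qE : map_poly (tu_in K N) q = map_poly (tu_in K (maxn N M)) (\poly_(i < size q) f q`_i).
  apply/polyP=> i; rewrite coef_map [RHS]coef_map coef_poly; case: ltnP => /= [_|?].
    exact: fP.
  by rewrite nth_default // !rmorph0.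
exists (maxn N M), ((\poly_(i < size q) f q`_i) * 'X + x'%:P).
by rewrite qE rmorphD rmorphM /= map_polyX map_polyC.
Qed.

(** [tu_field] carries only a field structure; a polynomial over it has its coefficients in a single
    stage, which is algebraically closed. *)
Lemma tower_union_splits (p : {poly K}) : exists rs : seq K, p = lead_coef p *: \prod_(r <- rs)
  ('X - r%:P).
Proof.
have [N [q ->]] := poly_from_tower p; have [rs qE] := closed_field_poly_normal q.
exists [seq tu_in K N r | r <- rs]; rewrite big_map lead_coef_map [in LHS]qE map_polyZ rmorph_prod.
by congr (_ *: _); apply: eq_bigr => r _; rewrite /= map_polyXsubC.
Qed.

Lemma tower_residue_homogeneous n N (x : 'rV[tow N]_n.+1) (a : 'rV[L]_n.+1) : Pi_tower x a ->
  exists2 c, c != 0 & forall j, tower_residue (c * x 0 j) (a 0 j).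
Proof.
elim: N x a => [|N IHN] x a /=.
  by case=> c c0 ->; exists c => // j; rewrite mxE.
case=> y [c [c0 cge0 _ cres]] /IHN[c' c'0 c'P].
exists (lc_constM (closure (tow N)) c' * c) => [|j]; first by rewrite mulf_neq0 ?fmorph_eq0.
exists (c' * y 0 j) => //; rewrite -mulrA; apply: has_residueM => //.
exact: has_residue_const.
Qed.

Lemma Pi_tower_affine n N (x : 'rV[tow N]_n) (a : 'rV[L]_n) :
  (forall j, tower_residue (x 0 j) (a 0 j)) -> Pi_tower (affine_to_proj x) (affine_to_proj a).
Proof.
elim: N x => [|N IHN] x xa /=.
  exists 1; rewrite ?oner_neq0 // scale1r; congr affine_to_proj.
  by apply/rowP=> j; rewrite xa.
have /choice[y yP] (j : 'I_n) : exists y : tow N,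
    @has_residue _ (closure (tow N)) (x 0 j) y /\ tower_residue y (a 0 j).
  by have [y xy ya] := xa j; exists y.
exists (affine_to_proj (\row_j y j)); last by apply: IHN => j; rewrite mxE; case: (yP j).
have R1 := @has_residue_const (tow N) (closure (tow N)) 1; rewrite rmorph1 in R1.
have R j : @has_residue _ (closure (tow N)) (affine_to_proj x 0 j) (affine_to_proj (\row_j y j) 0
  j).
  case: (@split_ordP 1 n j) => i ->; first by rewrite (ord1 i) !affine_to_proj_l.
  by rewrite !affine_to_proj_r mxE; case: (yP i).
exists 1; split; rewrite ?oner_neq0 //.
- by move=> j; rewrite mul1r; apply: has_residue_ge0 (R j).
- exists (lshift n (0 : 'I_1)); rewrite mul1r affine_to_proj_l.
  by rewrite /val_eq0 oner_neq0 (val1 (@lc_valuation _ _)) eqxx.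
- by move=> j; rewrite mul1r.
Qed.

Lemma inf_nbhd_residue n (x : 'rV[K]_n) (a : 'rV[L]_n) :
  inf_nbhd a x <-> forall j, union_residue (x 0 j) (a 0 j).
Proof.
have union_residueV z b : union_residue z b -> b != 0 -> union_residue z^-1 b^-1.
  move=> zb b0; have [[b' zb']|[z0]] := union_residue_total z^-1.
    suff -> : b^-1 = b' by [].
    have z0 : z != 0.
      by apply: contraNneq b0 => z0; apply/eqP/(union_residue_uniq zb);
        rewrite z0 -(rmorph0 (base_incl K)); apply: union_residue_base.
    apply: (mulfI b0); rewrite divff //; apply: union_residue_uniq (union_residueM zb zb').
    by rewrite divff // -(rmorph1 (base_incl K)); apply: union_residue_base.
  by rewrite invrK => z_0; rewrite (union_residue_uniq zb z_0) eqxx in b0.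
split=> [[N [c [y [c0 cx /tower_residue_homogeneous[d d0 dP]]]]] j|xa].
  have resP i : union_residue (tu_in K N d * c * affine_to_proj x 0 i) (affine_to_proj a 0 i).
    exists N, (d * y 0 i); split; last exact: dP.
    by rewrite rmorphM -mulrA; congr (_ * _); move/rowP: cx => /(_ i); rewrite !mxE.
  have := resP (lshift n (0 : 'I_1)); rewrite !affine_to_proj_l mulr1 => dc1.
  have := resP (rshift 1 j); rewrite !affine_to_proj_r => dcx.
  have := union_residueM (union_residueV _ _ dc1 (oner_neq0 _)) dcx.
  by rewrite mulKf ?mulf_neq0 ?fmorph_eq0 // invr1 mul1r.
have /choice[M MP] (j : 'I_n) : exists N, forall M, (N <= M)%N ->
    exists y : tow M, x 0 j = tu_in K M y /\ tower_residue y (a 0 j).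
  exact: union_residue_lift (xa j).
pose N := \max_j M j.
have /choice[y yP] (j : 'I_n) : exists y : tow N, x 0 j = tu_in K N y /\ tower_residue y (a 0 j).
  by apply: MP; apply: leq_bigmax.
exists N, 1, (affine_to_proj (\row_j y j)); split; rewrite ?oner_neq0 //.
  rewrite scale1r; apply/rowP=> j; rewrite [RHS]mxE.
  case: (@split_ordP 1 n j) => i ->; first by rewrite (ord1 i) !affine_to_proj_l rmorph1.
  by rewrite !affine_to_proj_r mxE; case: (yP i).
by apply: Pi_tower_affine => j; rewrite mxE; case: (yP j).
Qed.

End TowerResidue.

(** * Roots in the maximal ideal of a valuation ring *)

Section Place.
Variables (L : fieldType) (K : fieldType) (iota : {rmorphism L -> K}).
Variable res : K -> L -> Prop.
Hypothesis res_uniq : forall z a b, res z a -> res z b -> a = b.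
Hypothesis res_base : forall c, res (iota c) c.
Hypothesis resB : forall z w a b, res z a -> res w b -> res (z - w) (a - b).
Hypothesis resM : forall z w a b, res z a -> res w b -> res (z * w) (a * b).
Hypothesis res_total : forall z, (exists a, res z a) \/ (z != 0 /\ res z^-1 0).

Lemma res0 : res 0 0. Proof. by have := res_base 0; rewrite rmorph0. Qed.
Lemma res1 : res 1 1. Proof. by have := res_base 1; rewrite rmorph1. Qed.

Lemma resD z w a b : res z a -> res w b -> res (z + w) (a + b).
Proof.
move=> za wb; have := resB za (resB res0 wb).
by rewrite !sub0r !opprK.
Qed.

Lemma resX z a n : res z a -> res (z ^+ n) (a ^+ n).
Proof. by move=> za; elim: n => [|n IHn]; rewrite ?expr0 ?exprS; [exact: res1|exact: resM]. Qed.

Lemma res_sum I (r : seq I) (F : I -> K) (G : I -> L) : (forall i, res (F i) (G i)) ->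
  res (\sum_(i <- r) F i) (\sum_(i <- r) G i).
Proof.
move=> FG; elim: r => [|i r IHr]; first by rewrite !big_nil; apply: res0.
by rewrite !big_cons; apply: resD.
Qed.

Definition res_poly (p : {poly K}) (q : {poly L}) := forall i, res p`_i q`_i.

Lemma res_poly_uniq p q q' : res_poly p q -> res_poly p q' -> q = q'.
Proof. by move=> pq pq'; apply/polyP=> i; apply: res_uniq (pq i) (pq' i). Qed.

Lemma res_polyM p q p' q' : res_poly p q -> res_poly p' q' -> res_poly (p * p') (q * q').
Proof.
move=> pq pq' i; rewrite !coefM; apply: res_sum => j.
exact: resM.
Qed.

Lemma res_polyZ c a p q : res c a -> res_poly p q -> res_poly (c *: p) (a *: q).
Proof. by move=> ca pq i; rewrite !coefZ; apply: resM. Qed.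

(* Factors with a root outside the valuation ring are rescaled to 1 - r^-1 'X,
   whose reduction is 1. *)
Lemma res_poly_prod (rs : seq K) : exists u p q,
  [/\ u != 0, \prod_(r <- rs) ('X - r%:P) = u *: p, res_poly p q, q != 0
    & mup 0 q = size [seq r <- rs | `[< res r 0 >]]].
Proof.
elim: rs => [|r rs [u [p [q [u0 pE pq q0 qE]]]]].
  exists 1, 1, 1; rewrite big_nil scale1r !oner_neq0; split=> // [i|].
    by rewrite !coef1; case: eqP => _; [exact: res1|exact: res0].
  by rewrite mupNroot // root1.
rewrite big_cons pE /=; have [[a ra]|[r0 rV]] := res_total r.
  exists u, (('X - r%:P) * p), (('X - a%:P) * q); split=> //.
  - by rewrite scalerAr.
  - apply: res_polyM => // i; rewrite !coefB !coefX !coefC.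
    by apply: resB; case: eqP => _ //; [exact: res1|exact: res0|exact: res0].
  - by rewrite mulf_neq0 // polyXsubC_eq0.
  - rewrite mupM ?polyXsubC_eq0 // qE (@mup_XsubCX _ 1).
    have [a0|a0] := eqVneq a 0; first by rewrite asboolT //= -a0.
    by rewrite asboolF // => r0; case/eqP: a0; apply: res_uniq ra r0.
exists (- r * u), ((1 - r^-1 *: 'X) * p), q; split=> //.
- by rewrite mulf_neq0 ?oppr_eq0.
- have E : 'X - r%:P = (- r)%:P * (1 - r^-1%:P * 'X) :> {poly K}.
    by rewrite mulrBr mulr1 mulrA -polyCM mulNr divff // !polyCN mulN1r opprK addrC.
  by rewrite E -!mul_polyC polyCM; ring.
- rewrite -[q]mul1r; apply: res_polyM => // i; rewrite coefB coefZ coefX !coef1.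
  have := resB (res_base (i == 0)%N%:R) (resM rV (res_base (i == 1)%N%:R)).
  by rewrite mul0r subr0 !rmorph_nat.
- rewrite asboolF // => r_res0.
  have := resM r_res0 rV; rewrite divff // mul0r => /res_uniq/(_ res1)/esym/eqP.
  by rewrite oner_eq0.
Qed.

(** By [res_poly_prod], [f = c p] where the nonzero reduction of [p] has the right multiplicity at
    0. The scalar [c] has a nonzero residue: were it infinite, [p = c^-1 f] would reduce to 0; were
    it infinitesimal, [f0] would be 0. *)
Lemma infinitesimal_roots (f : {poly K}) (f0 : {poly L}) (rs : seq K) :
    f = lead_coef f *: \prod_(r <- rs) ('X - r%:P) -> f0 != 0 -> res_poly f f0 ->
  size [seq r <- rs | `[< res r 0 >]] = mup 0 f0.
Proof.
move=> fE f00 ff0; have [u [p [q [u0 pE pq q0 <-]]]] := res_poly_prod rs.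
have [c fcp] : exists c, f = c *: p by exists (lead_coef f * u); rewrite {1}fE pE scalerA.
have [[a ca]|[c0 cV]] := res_total c.
  have f0E : f0 = a *: q.
    by apply: (res_poly_uniq ff0); rewrite fcp; apply: res_polyZ.
  have a0 : a != 0 by apply: contraNneq f00 => a0; rewrite f0E a0 scale0r.
  by rewrite f0E -mul_polyC mupMr // rootC.
have pE' : p = c^-1 *: f by rewrite fcp scalerA mulVf // scale1r.
have := res_polyZ cV ff0; rewrite -pE' => /(res_poly_uniq pq) q_eq0.
by rewrite q_eq0 scale0r eqxx in q0.
Qed.

Lemma res_horner2 (P : {poly {poly L}}) z w a b : res z a -> res w b ->
  res (eval2 iota z w P) (eval2 idfun a b P).
Proof.
move=> za wb; elim/poly_ind: P => [|P p IHP]; first by rewrite !rmorph0; apply: res0.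
rewrite !rmorphD !rmorphM /= !eval2Y; apply: resD; first exact: resM.
elim/poly_ind: p => [|p c IHp]; first by rewrite !polyC0 !rmorph0; apply: res0.
rewrite polyCD polyCM !rmorphD !rmorphM /= !eval2X !eval2C.
by apply: resD => //; apply: resM.
Qed.

Lemma res_meval (p : {mpoly L[2]}) (z : 'I_2 -> K) (a : 'I_2 -> L) :
  (forall i, res (z i) (a i)) -> res (map_mpoly iota p).@[z] p.@[a].
Proof.
move=> za; elim/mpolyind: p => [|c m p _ _ IHp]; first by rewrite !rmorph0; apply: res0.
rewrite !rmorphD /= map_mpolyZ !mevalZ map_mpolyX !mevalX.
apply: resD => //; apply: resM => //.
elim/big_ind2: _ => [|? ? ? ? ? ?|i _]; [exact: res1|exact: resM|exact: resX].
Qed.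

(** Equal sizes mean that the leading coefficient of [p] has nonzero residue. If [z] were infinite,
    dividing the equation by the top power of [z] and reducing would leave only that residue, equal
    to 0. *)
Lemma res_integral (p : {poly K}) (q : {poly L}) z : res_poly p q -> size p = size q ->
  q != 0 -> root p z -> exists b, res z b.
Proof.
move=> pq sz q0 pz; have [//|[z0 zV]] := res_total z.
have q_gt0 : (0 < size q)%N by rewrite size_poly_gt0.
have : \sum_(i < size q) p`_i * z^-1 ^+ ((size q).-1 - i) = 0.
  have zn0 : z ^+ (size q).-1 != 0 by rewrite expf_neq0.
  apply: (mulIf zn0); rewrite mul0r mulr_suml -[RHS](eqP pz) horner_coef sz.
  apply: eq_bigr => i _; rewrite -mulrA exprVn; congr (_ * _).
  have le_i : (i <= (size q).-1)%N by rewrite -ltnS prednK.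
  rewrite -{2}(subnKC le_i) exprD mulrCA mulVf ?mulr1 //.
  by rewrite expf_neq0.
move=> sum0; have : res 0 (\sum_(i < size q) q`_i * 0 ^+ ((size q).-1 - i)).
  by rewrite -[X in res X _]sum0; apply: res_sum => i; apply: resM => //; apply: resX.
move=> /res_uniq/(_ res0).
have lt_q : ((size q).-1 < size q)%N by rewrite prednK.
rewrite (bigD1 (Ordinal lt_q)) //= subnn expr0 mulr1 big1 ?addr0 => [/eqP|i].
  by rewrite -lead_coefE lead_coef_eq0 (negPf q0).
rewrite -val_eqE /= => ni; rewrite expr0n subn_eq0.
have le_i : (i <= (size q).-1)%N by rewrite -ltnS prednK.
by rewrite leqNgt ltn_neqAle ni le_i mulr0.
Qed.

End Place.

(** The polynomial may live over [K] while the value is sought in [L], as for shears depending on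
    [eps]. In characteristic 0 the first [size h] natural numbers stay distinct in [K], too many to
    be all roots of [h]. *)
Lemma nonroot_exists (L K : fieldType) (iota : {rmorphism L -> K}) (h : {poly K}) :
  [pchar L] =i pred0 -> h != 0 -> exists c, h.[iota c] != 0.
Proof.
move=> charL h0; apply: contrapT => /forallNP nex.
pose rs := [seq iota i%:R | i <- seq.iota 0 (size h)].
have := @max_poly_roots _ h rs h0; rewrite size_map size_iota ltnn => H.
suff : false by [].
apply: H.
  by apply/allP => _ /mapP[i _ ->]; rewrite rootE; apply/negPn/negP; apply: nex.
rewrite map_inj_uniq ?iota_uniq // => i j /fmorph_inj/eqP.
wlog le_ij : i j / (i <= j)%N => [W|].
  by case: (leqP i j) => [|/ltnW] le_ij ij; [|apply/esym]; apply: W => //; rewrite eq_sym.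
rewrite eq_sym -subr_eq0 -natrB // => /eqP; move/pcharf0P: charL => charL /eqP.
by rewrite charL subn_eq0 => le_ji; apply/eqP; rewrite eqn_leq le_ij.
Qed.

(** * The universal resultant *)

Section Pencil.
Variables (L : fieldType) (S : comNzRingType) (h : {rmorphism L -> S}).
Implicit Types (P Q : {poly {poly L}}) (u : S).

(** The fibre equation [P = u]: [S] is [L[u, v]] for the universal resultant, [K] for the fibre over
    [eps], and [L] for the fibre over the origin. *)
Definition pencil P u : {poly {poly S}} := map_poly (map_poly h) P - u%:P%:P.

Lemma unit_map_neq0 (c : {poly L}) : c \is a GRing.unit -> map_poly h c != 0.
Proof.
rewrite poly_unitE => /andP[/size_poly1P[c0 c00 ->] _].
rewrite map_polyC polyC_eq0 /=; apply: contraTneq (oner_neq0 S) => hc0.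
by rewrite -(rmorph1 h) -(mulfV c00) rmorphM hc0 mul0r eqxx.
Qed.

Lemma size_pencil P u : lead_coef P \is a GRing.unit -> (1 < size P)%N ->
  size (pencil P u) = size P.
Proof.
move=> leadP P1; rewrite size_polyDl size_map_poly_id0 ?unit_map_neq0 //.
by rewrite size_polyN (leq_ltn_trans _ P1) // size_polyC leq_b1.
Qed.

Lemma lead_pencil P u : lead_coef P \is a GRing.unit -> (1 < size P)%N ->
  lead_coef (pencil P u) = map_poly h (lead_coef P).
Proof.
move=> leadP P1; rewrite lead_coefDl ?lead_coef_map_id0 ?rmorph0 ?unit_map_neq0 //.
rewrite size_map_poly_id0 ?unit_map_neq0 // size_polyN (leq_ltn_trans _ P1) //.
by rewrite size_polyC leq_b1.
Qed.

Lemma eval2_pencil (S' : comNzRingType) (g : {rmorphism S -> S'}) x y P u :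
  eval2 g x y (pencil P u) = eval2 (g \o h) x y P - g u.
Proof.
rewrite /pencil eval2B eval2C; congr (_ - _).
apply: (eval2_unique (f := eval2 g x y \o map_poly (map_poly h))) => [c||] /=.
- by rewrite !map_polyC /= map_polyC eval2C.
- by rewrite !map_polyC /= map_polyX eval2X.
- by rewrite map_polyX eval2Y.
Qed.

End Pencil.

Lemma lead_pencil_unit (L K : fieldType) (h : {rmorphism L -> K}) P u :
  lead_coef P \is a GRing.unit -> (1 < size P)%N ->
  lead_coef (pencil h P u) \is a GRing.unit.
Proof. by move=> leadP P1; rewrite lead_pencil // rmorph_unit. Qed.

Lemma pencil_ext (L : fieldType) (S : comNzRingType) (h h' : {rmorphism L -> S}) P u :
  h =1 h' -> pencil h P u = pencil h' P u.
Proof.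
move=> hh'; rewrite /pencil; congr (_ - _); apply: eq_map_poly => p.
exact: eq_map_poly.
Qed.

Lemma map_pencil (L : fieldType) (S S' : comNzRingType) (h : {rmorphism L -> S})
    (f : {rmorphism S -> S'}) P u :
  map_poly (map_poly f) (pencil h P u) = pencil (f \o h) P (f u).
Proof.
rewrite /pencil rmorphB /= !map_polyC /= map_polyC /= -map_poly_comp; congr (_ - _).
by apply: eq_map_poly => p /=; rewrite -map_poly_comp.
Qed.

Lemma rmorph_comb0 (A S : comNzRingType) (phi : {rmorphism A -> S}) (a b p q c : A) :
  c = a * p + b * q -> phi p = 0 -> phi q = 0 -> phi c = 0.
Proof. by move=> -> p0 q0; rewrite rmorphD !rmorphM p0 q0 !mulr0 addr0. Qed.

(** The polynomial [R(u, v, x')], with ['X_0] for [u] and ['X_1] for [v]. *)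
Definition univ_resultant (L : fieldType) (P Q : {poly {poly L}}) : {poly {mpoly L[2]}} :=
  resultant (pencil (mpolyC 2 (R := L)) P 'X_0) (pencil (mpolyC 2 (R := L)) Q 'X_1).

Section UniversalResultant.
Variables (L : fieldType) (P Q : {poly {poly L}}).
Hypotheses (leadP : lead_coef P \is a GRing.unit) (P1 : (1 < size P)%N).
Hypotheses (leadQ : lead_coef Q \is a GRing.unit) (Q1 : (1 < size Q)%N).

Lemma map_univ_resultant (S : comNzRingType) (h : {rmorphism L -> S}) (f : {rmorphism {mpoly
  L[2]} -> S}) :
    (forall c, f c%:MP = h c) ->
  map_poly f (univ_resultant P Q) = resultant (pencil h P (f 'X_0)) (pencil h Q (f 'X_1)).
Proof.
move=> fh.
have E (T : {poly {poly L}}) u : map_poly (map_poly f) (pencil (mpolyC 2 (R := L)) T u) = pencil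
  h T (f u).
  by rewrite map_pencil; apply: pencil_ext.
have lead0 (T : {poly {poly L}}) u : lead_coef T \is a GRing.unit -> (1 < size T)%N ->
    map_poly f (lead_coef (pencil (mpolyC 2 (R := L)) T u)) != 0.
  move=> leadT T1; rewrite lead_pencil // -map_poly_comp.
  exact: (unit_map_neq0 (f \o mpolyC 2 (R := L))).
rewrite -(E P) -(E Q); apply: (map_resultant (f := map_poly f)); exact: lead0.
Qed.

(** The resultant is a combination of the two pencils, which vanish at [(x, y)] when [u], [v] are
    the values of [P], [Q] there. Taking for [x], [y] polynomials instead of scalars makes [x + l y]
    algebraic over [L(p1, p2)]. *)
Lemma univ_resultant_relation (S : comNzRingType) (h : {rmorphism L -> S})
    (f : {rmorphism {mpoly L[2]} -> S}) (x y : S) :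
    (forall c, f c%:MP = h c) -> f 'X_0 = eval2 h x y P -> f 'X_1 = eval2 h x y Q ->
  (map_poly f (univ_resultant P Q)).[x] = 0.
Proof.
move=> fh fX fY.
have [|| [a b] _ /= E] := @resultant_in_ideal _ (pencil (mpolyC 2 (R := L)) P 'X_0) (pencil
  (mpolyC 2 (R := L)) Q 'X_1).
- by rewrite size_pencil.
- by rewrite size_pencil.
have eh (T : {poly {poly L}}) : eval2 (f \o mpolyC 2 (R := L)) x y T = eval2 h x y T.
  apply: eval2_unique => [c||].
  - by apply: etrans (eval2C _ _ _ _) _; apply: fh.
  - exact: eval2X.
  - exact: eval2Y.
have P0 : eval2 f x y (pencil (mpolyC 2 (R := L)) P 'X_0) = 0.
  by rewrite eval2_pencil eh fX subrr.
have Q0 : eval2 f x y (pencil (mpolyC 2 (R := L)) Q 'X_1) = 0.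
  by rewrite eval2_pencil eh fY subrr.
transitivity (eval2 f x y (univ_resultant P Q)%:P).
  by rewrite /eval2 /= map_polyC /horner_eval hornerC.
exact: (rmorph_comb0 (phi := eval2 f x y) E P0 Q0).
Qed.

End UniversalResultant.

(** * The Jacobian at a generic point *)

Section DerivationKillsAlgebraic.
Variables (A S K : idomainType) (comp : {rmorphism A -> S}) (ev : {rmorphism S -> K}).
Variable D : S -> K.
Hypothesis natA : forall n, n.+1%:R != 0 :> A.
Hypothesis DD : forall f g, D (f + g) = D f + D g.
Hypothesis DM : forall f g, D (f * g) = D f * ev g + ev f * D g.
Hypothesis Dcomp : forall c, D (comp c) = 0.
Hypothesis ev_comp_inj : forall c, ev (comp c) = 0 -> c = 0.
Variable x : S.
Local Notation Psi G := ((map_poly comp G).[x]).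

Lemma derivation_horner (G : {poly A}) : D (Psi G) = ev (Psi G^`()) * D x.
Proof.
elim/poly_ind: G => [|G c IHG].
  by rewrite deriv0 !rmorph0 !horner0 -[X in D X](rmorph0 comp) Dcomp rmorph0 mul0r.
rewrite derivD derivC addr0 derivM derivX mulr1 !rmorphD !rmorphM /= map_polyC map_polyX.
rewrite !hornerE DD DM Dcomp addr0 IHG rmorphD rmorphM /=.
by rewrite mulrDl mulrAC.
Qed.

Lemma size_deriv0 (G : {poly A}) : size G^`() = (size G).-1.
Proof.
have [sG|sG] := leqP (size G) 1.
  by rewrite [G]size1_polyC // derivC size_poly0 size_polyC; case: eqP.
apply/eqP; rewrite eqn_leq; apply/andP; split.
  rewrite -ltnS prednK ?(ltnW sG) //; apply: lt_size_deriv.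
  by rewrite -size_poly_gt0 ltnW.
rewrite leqNgt; apply/negP => sG'; have : G^`()`_(size G).-2 = 0.
  by apply: nth_default; move: sG sG'; case: (size G) => [|[]].
rewrite coef_deriv -mulr_natr => /eqP; rewrite mulf_eq0 (negPf (natA _)) orbF.
have -> : (size G).-2.+1 = (size G).-1 by case: (size G) sG => [|[]].
rewrite -lead_coefE lead_coef_eq0 -size_poly_eq0.
by case: (size G) sG.
Qed.

(* For a relation [F] of minimal degree, the resultant of [F] and its derivative
   is nonzero, so the derivative does not vanish at [x]. *)
Lemma derivation_kills_algebraic (G : {poly A}) : G != 0 -> Psi G = 0 -> D x = 0.
Proof.
move=> G0 PsiG.
have exF : exists n, `[< exists F : {poly A}, [/\ F != 0, Psi F = 0 & size F = n] >].
  by exists (size G); apply/asboolP; exists G.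
have [n /asboolP[F [F0 PsiF sF]] Fmin] := ex_minnP exF.
have {}Fmin (H : {poly A}) : Psi H = 0 -> (size H < size F)%N -> H = 0.
  move=> PsiH; apply: contraTeq => H0; rewrite -leqNgt sF; apply: Fmin.
  by apply/asboolP; exists H.
have sF1 : (1 < size F)%N.
  rewrite ltnNge; apply: contraNN F0 => /size1_polyC FE.
  move: PsiF; rewrite FE map_polyC hornerC /= => c0.
  by rewrite (ev_comp_inj (etrans (congr1 ev c0) (rmorph0 _))).
have sF' := size_deriv0 F.
(* The derivative itself if it is constant, otherwise the resultant. Were the latter 0, [F] would
   be, up to a factor in [A], a product of two polynomials of smaller size, one of which vanishes at
   [x], against minimality. *)
have [delta [a [b [delta0 deltaE]]]] : exists delta a b,
    delta != 0 /\ delta%:P = a * F + b * F^`().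
  have [sF'1|sF'1] := ltnP 1 (size F^`()); last first.
    exists F^`()`_0, 0, 1; rewrite mul0r add0r mul1r -size1_polyC //; split=> //.
    rewrite -polyC_eq0 -size1_polyC // -size_poly_gt0 sF'.
    by case: (size F) sF1 => [|[]].
  have [[a b] _ /= E] := resultant_in_ideal sF1 sF'1.
  exists (resultant F F^`()), a, b; split=> //.
  rewrite resultant_eq0 -leqNgt; rewrite leqNgt; apply/negP => sg.
  have /Pdiv.Idomain.dvdpP[[c q] /= c0 cF] := dvdp_gcdl F F^`().
  set g := gcdp F F^`() in sg cF.
  have F'0 : F^`() != 0 by rewrite -size_poly_gt0 ltnW.
  have g0 : g != 0 by rewrite -size_poly_gt0 ltnW.
  have q0 : q != 0.
    apply: contraNneq F0 => q0; move/eqP: cF.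
    by rewrite q0 mul0r -mul_polyC mulf_eq0 polyC_eq0 (negPf c0).
  have sqg : size F = (size q + size g).-1 by rewrite -size_mul // -cF -mul_polyC size_Cmul.
  have /eqP : Psi q * Psi g = 0.
    by rewrite -hornerM -rmorphM -cF -mul_polyC rmorphM /= hornerM PsiF mulr0.
  rewrite mulf_eq0 => /orP[] /eqP Psi0.
    by case/eqP: q0; apply: Fmin Psi0 _; rewrite sqg; case: (size g) sg => [|[|n']] // _;
      rewrite !addnS ltnS leq_addr.
  case/eqP: g0; apply: Fmin Psi0 _; apply: (@leq_ltn_trans (size F^`())).
    by rewrite dvdp_leq // dvdp_gcdr.
  by rewrite sF' prednK // ltnW.
have := derivation_horner F; rewrite PsiF -[X in D X](rmorph0 comp) Dcomp.
move/esym/eqP; rewrite mulf_eq0 => /orP[/eqP evF'|/eqP //].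
have : ev (comp delta) = 0.
  have := congr1 (fun p => ev (Psi p)) deltaE.
  by rewrite map_polyC hornerC /= => ->; rewrite rmorphD !rmorphM /= !hornerE PsiF mulr0 add0r
    rmorphM /= evF' mulr0.
by move/ev_comp_inj/eqP; rewrite (negPf delta0).
Qed.

End DerivationKillsAlgebraic.

Section PartialRules.
Variables (K : fieldType) (xi eta : K).
Implicit Types f g : {poly {poly K}}.
Local Notation d1 := (partial1 xi eta).
Local Notation d2 := (partial2 xi eta).
Local Notation at_z f := (f.[eta%:P].[xi]).

Lemma partial1D f g : d1 (f + g) = d1 f + d1 g.
Proof. by rewrite /partial1 hornerD derivD hornerD. Qed.
Lemma partial2D f g : d2 (f + g) = d2 f + d2 g.
Proof. by rewrite /partial2 derivD !hornerD. Qed.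
Lemma partial1M f g : d1 (f * g) = d1 f * at_z g + at_z f * d1 g.
Proof. by rewrite /partial1 hornerM derivM !(hornerD, hornerM). Qed.
Lemma partial2M f g : d2 (f * g) = d2 f * at_z g + at_z f * d2 g.
Proof. by rewrite /partial2 derivM !(hornerD, hornerM). Qed.
Lemma partial1C c : d1 c%:P%:P = 0.
Proof. by rewrite /partial1 hornerC derivC horner0. Qed.
Lemma partial2C c : d2 c%:P%:P = 0.
Proof. by rewrite /partial2 derivC !horner0. Qed.
Lemma partial1X : d1 'X%:P = 1.
Proof. by rewrite /partial1 hornerC derivX hornerC. Qed.
Lemma partial2X : d2 'X%:P = 0.
Proof. by rewrite /partial2 derivC !horner0. Qed.
Lemma partial1Y : d1 'X = 0.
Proof. by rewrite /partial1 hornerX derivC horner0. Qed.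
Lemma partial2Y : d2 'X = 1.
Proof. by rewrite /partial2 derivX !hornerC. Qed.

Lemma singular_direction (a b c d : K) : a * d - b * c = 0 ->
  exists w1 w2, [/\ (w1 != 0) || (w2 != 0), w1 * a + w2 * b = 0 & w1 * c + w2 * d = 0].
Proof.
move=> det0; have [/andP[/eqP a0 /eqP b0]|ab] := boolP ((a == 0) && (b == 0)).
  have [/andP[/eqP c0 /eqP d0]|cd] := boolP ((c == 0) && (d == 0)).
    by exists 1, 0; rewrite oner_neq0 a0 b0 c0 d0 !mulr0 addr0.
  exists (- d), c; rewrite oppr_eq0 a0 b0 !mulr0 addr0 orbC -negb_and; split=> //; ring.
exists (- b), a; rewrite oppr_eq0 orbC -negb_and; split=> //; first by ring.
by rewrite -det0; ring.
Qed.

End PartialRules.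

Lemma leibniz_combine (R : comNzRingType) (w1 w2 a b c d f g : R) :
  w1 * (a * g + f * b) + w2 * (c * g + f * d) = (w1 * a + w2 * c) * g + f * (w1 * b + w2 * d).
Proof. by ring. Qed.

Section Jacobian.
Variables (L K : fieldType) (iota : {rmorphism L -> K}) (p1 p2 : {mpoly L[2]}) (l1 l2 : L).
Hypothesis charL : [pchar L] =i pred0.
Hypothesis l12 : l1 != l2.
Hypothesis lead_unit : forall l p, l \in [:: l1; l2] -> p \in [:: p1; p2] ->
  lead_coef (shear l p) \is a GRing.unit /\ (1 < size (shear l p))%N.
Hypothesis res_neq0 : forall l, l \in [:: l1; l2] -> univ_resultant (shear l p1) (shear l p2) != 0.
Variable z : 'I_2 -> K.
Local Notation ev := (meval z \o map_mpoly iota).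
Variable eps : 'I_2 -> K.
Hypotheses (eps0 : ev p1 = eps 0) (eps1 : ev p2 = eps 1).
Hypothesis eps_generic : forall c : {mpoly L[2]}, (map_mpoly iota c).@[eps] = 0 -> c = 0.

Definition substitute : {mpoly L[2]} -> {mpoly L[2]} :=
  mmap (mpolyC 2 (R := L)) (fun i => if i == 0 then p1 else p2).
HB.instance Definition _ := GRing.RMorphism.copy substitute
  (mmap (mpolyC 2 (R := L)) (fun i => if i == 0 then p1 else p2)).

Lemma substituteC c : substitute c%:MP = c%:MP. Proof. exact: mmapC. Qed.
Lemma substituteX0 : substitute 'X_0 = p1. Proof. by rewrite /substitute mmapX mmap1U. Qed.
Lemma substituteX1 : substitute 'X_1 = p2. Proof. by rewrite /substitute mmapX mmap1U. Qed.

Lemma ev_substitute c : ev (substitute c) = (map_mpoly iota c).@[eps].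
Proof.
apply: (mpoly_rmorph_ext (f := ev \o substitute) (g := meval eps \o map_mpoly iota)) => [a|i].
  by rewrite -[LHS]/(ev (substitute a%:MP)) substituteC /= !map_mpolyC !mevalC.
rewrite -[LHS]/(ev (substitute 'X_i)) [RHS]/= map_mpolyX mevalXU;
  have [->|/eqP/ord2_neq0 ->] := eqVneq i 0.
  by rewrite substituteX0.
by rewrite substituteX1.
Qed.

Lemma nat_mpoly_neq0 n : n.+1%:R != 0 :> {mpoly L[2]}.
Proof.
rewrite -mpolyC1 -raddfMn /= mpolyC_eq0.
by move/pcharf0P: charL => ->.
Qed.

Let xi := z 0 + iota l1 * z 1.
Let eta := z 1.
Local Notation lift q := (map_poly (map_poly iota) (shear l1 q)).

Lemma eval_lift q : (lift q).[eta%:P].[xi] = ev q.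
Proof.
rewrite horner2E /= -(eval2_shear l1 iota z q).
apply: (eval2_unique (f := eval2 idfun xi eta \o map_poly (map_poly iota))) => [c||] /=.
- by rewrite !map_polyC /= map_polyC eval2C.
- by rewrite !map_polyC /= map_polyX eval2X.
- by rewrite map_polyX eval2Y.
Qed.

Section Direction.
Variables w1 w2 : K.
(** The point derivation at [z] along the tangent vector [(w1, w2)], in the coordinates of the shear
    [l1]. *)
Definition direction_derivative q := w1 * partial1 xi eta (lift q) + w2 * partial2 xi eta (lift q).
Local Notation D := direction_derivative.
Hypotheses (Dp1 : D p1 = 0) (Dp2 : D p2 = 0).

Lemma direction_derivativeD f g : D (f + g) = D f + D g.
Proof.
rewrite /D [shear l1 (f + g)]rmorphD [map_poly _ (_ + _)]rmorphD partial1D partial2D.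
by rewrite !mulrDr addrACA.
Qed.

Lemma direction_derivativeM f g : D (f * g) = D f * ev g + ev f * D g.
Proof.
rewrite /D [shear l1 (f * g)]rmorphM [map_poly _ (_ * _)]rmorphM partial1M partial2M.
rewrite -(eval_lift f) -(eval_lift g).
exact: leibniz_combine.
Qed.

Lemma direction_derivativeC c : D c%:MP = 0.
Proof. by rewrite /D shearC !map_polyC /= map_polyC partial1C partial2C !mulr0 addr0. Qed.

Lemma direction_derivativeX l : D ('X_0 + l%:MP * 'X_1) = w1 + w2 * iota (l - l1).
Proof.
have -> : 'X_0 + l%:MP * 'X_1 = unshear l1 'X%:P + (l - l1)%:MP * unshear l1 'X.
  by rewrite /unshear eval2X eval2Y mpolyCB; ring.
rewrite direction_derivativeD direction_derivativeM direction_derivativeC mul0r add0r /=.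
rewrite map_mpolyC mevalC /D !unshearK !map_polyC /= !map_polyX.
by rewrite partial1X partial2X partial1Y partial2Y; ring.
Qed.

Lemma direction_derivative_substitute c : D (substitute c) = 0.
Proof.
have DM0 f g : D f = 0 -> D g = 0 -> D (f * g) = 0.
  by move=> f0 g0; rewrite direction_derivativeM f0 g0 mul0r mulr0 addr0.
elim/mpolyind: c => [|a m c _ _ IHc].
  by rewrite rmorph0 -mpolyC0 direction_derivativeC.
have -> : substitute (a *: 'X_[m] + c) = a%:MP * substitute 'X_[m] + substitute c.
  by rewrite rmorphD -mul_mpolyC rmorphM /= substituteC.
rewrite direction_derivativeD IHc addr0.
apply: (DM0); first exact: direction_derivativeC.
rewrite mpolyXE_id rmorph_prod /=; apply: (big_ind (fun f => D f = 0)) => [||i _].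
- by rewrite -mpolyC1 direction_derivativeC.
- exact: (DM0).
rewrite rmorphXn /=; have Di : D (substitute 'X_i) = 0.
  by have [->|/eqP/ord2_neq0 ->] := eqVneq i 0; rewrite ?substituteX0 ?substituteX1.
elim: (m i) => [|n IHn]; first by rewrite expr0 -mpolyC1 direction_derivativeC.
by rewrite exprS; apply: (DM0).
Qed.

(** Both [x + l1 y] and [x + l2 y] are algebraic over [L(p1, p2)], so the derivation kills them; its
    values there are [w1] and [w1 + w2 (l2 - l1)]. *)
Lemma direction_zero : w1 = 0 /\ w2 = 0.
Proof.
have kill l : l \in [:: l1; l2] -> w1 + w2 * iota (l - l1) = 0.
  move=> ll; rewrite -direction_derivativeX.
  have [lead1 s1] := lead_unit ll (mem_head _ _ : p1 \in [:: p1; p2]).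
  have [lead2 s2] : lead_coef (shear l p2) \is a GRing.unit /\ (1 < size (shear l p2))%N.
    by apply: lead_unit => //; rewrite !inE eqxx orbT.
  apply: (derivation_kills_algebraic nat_mpoly_neq0 direction_derivativeD direction_derivativeM
    direction_derivative_substitute _ (res_neq0 ll)).
    by move=> c evc; apply: eps_generic; rewrite -evc; apply/esym/ev_substitute.
  apply: (univ_resultant_relation lead1 s1 lead2 s2 (h := mpolyC 2 (R := L)) (y := 'X_1)).
  - exact: substituteC.
  - by apply: etrans substituteX0 _; apply/esym/shearK.
  - by apply: etrans substituteX1 _; apply/esym/shearK.
have w10 : w1 = 0.
  by have := kill l1 (mem_head _ _); rewrite subrr rmorph0 mulr0 addr0.
have := kill l2; rewrite !inE eqxx orbT w10 add0r => /(_ isT)/eqP.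
by rewrite mulf_eq0 fmorph_eq0 subr_eq0 [l2 == _]eq_sym (negPf l12) orbF => /eqP.
Qed.

End Direction.

Local Notation P u := (pencil iota (shear l1 p1) u).
Local Notation Q u := (pencil iota (shear l1 p2) u).

Lemma jacobian_neq0 u1 u2 :
  partial1 xi eta (P u1) * partial2 xi eta (Q u2)
    - partial2 xi eta (P u1) * partial1 xi eta (Q u2) != 0.
Proof.
apply/negP => /eqP/singular_direction[w1 [w2 [w0 DP DQ]]].
have drop p u : partial1 xi eta (pencil iota (shear l1 p) u) = partial1 xi eta (lift p) /\
    partial2 xi eta (pencil iota (shear l1 p) u) = partial2 xi eta (lift p).
  by rewrite /pencil -!polyCN partial1D partial2D partial1C partial2C !addr0.
have [w10 w20] : w1 = 0 /\ w2 = 0.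
  apply: direction_zero; rewrite /direction_derivative.
    by move: DP; rewrite (drop _ _).1 (drop _ _).2.
  by move: DQ; rewrite (drop _ _).1 (drop _ _).2.
by rewrite w10 w20 eqxx in w0.
Qed.

End Jacobian.

(** * Generic shears *)

Lemma mdeg2 (m : 'X_{1..2}) : mdeg m = (m 0%R + m 1%R)%N.
Proof.
rewrite mdegE big_ord_recl big_ord1.
by congr (m _ + m _)%N; apply: val_inj.
Qed.

Section GenericShear.
Variables (L : fieldType) (p : {mpoly L[2]}).
Hypotheses (p0 : p != 0) (p_origin : p.@[(0 : 'rV[L]_2) 0] = 0).
Local Notation deg := (msize p).-1.

Lemma shear_monomial (l : L) a b i : (a + b <= i)%N ->
  (('X%:P - l%:P%:P * 'X) ^+ a * 'X ^+ b : {poly {poly L}})`_i =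
  if i == (a + b)%N then ((- l) ^+ a)%:P else 0.
Proof.
move=> le_i; rewrite coefMXn ltnNge (leq_trans (leq_addl a b) le_i) /=.
have -> : (i == a + b)%N = (i - b == a)%N by lia.
have : (a <= i - b)%N by lia.
elim: a (i - b)%N {le_i} => [|a IHa] j le_j; first by rewrite !expr0 coef1; case: eqP.
rewrite exprSr mulrBr mulrA coefB coefMC coefMX coefMC.
rewrite (IHa j); last by apply: ltnW.
have -> : (j == a)%N = false by lia.
rewrite mul0r sub0r; case: j le_j => // j le_j; rewrite /= IHa // eqSS.
case: eqP => _; last by rewrite mul0r oppr0.
by rewrite -polyCM -polyCN exprSr mulrN.
Qed.

Lemma shear_coef l i : (deg <= i)%N -> (shear l p)`_i =
  (\sum_(m <- msupp p | mdeg m == i) p@_m * (- l) ^+ m 0)%:P.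
Proof.
move=> le_i; rewrite /shear /mmap coef_sum rmorph_sum big_seq [RHS]big_seq_cond [RHS]big_mkcondr /=.
apply: eq_bigr => m mp; rewrite coefCM /mmap1 big_ord_recl big_ord1.
have -> : ord0 = 0 :> 'I_2 by apply: val_inj.
have -> : lift 0 0 = 1 :> 'I_2 by apply: val_inj.
rewrite /shear_var /= shear_monomial -mdeg2 1?eq_sym.
  by case: eqP => _; rewrite ?polyCM ?mulr0.
by apply: leq_trans le_i; have := msize_mdeg_lt mp; case: (msize p).
Qed.

Lemma deg_gt0 : (0 < deg)%N.
Proof.
rewrite -ltnS prednK ?lt0n ?msize_poly_eq0 // ltnNge; apply/negP => /msize1_polyC pE.
by move: p_origin p0; rewrite pE mevalC => ->; rewrite mpolyC0 eqxx.
Qed.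

(** The coefficient of [y'] to the power [deg] is the top homogeneous form of [p] at [(- l, 1)], a
    constant in [x']; [h] is this value as a polynomial in [l]. Vanishing at the origin excludes
    constant [p]. *)
Lemma generic_shear_lead : exists2 h : {poly L}, h != 0 &
  forall l, h.[l] != 0 -> lead_coef (shear l p) \is a GRing.unit /\ (1 < size (shear l p))%N.
Proof.
pose h : {poly L} := \sum_(m <- msupp p | mdeg m == deg) (p@_m * (-1) ^+ m 0) *: 'X^(m 0).
have hE l : h.[l] = \sum_(m <- msupp p | mdeg m == deg) p@_m * (- l) ^+ m 0.
  rewrite horner_sum; apply: eq_bigr => m _.
  by rewrite hornerZ hornerXn -mulrA -exprMn mulN1r.
exists h => [|l hl].
  have /mlead_supp lead_p := p0; have deg_lead : mdeg (mlead p) = deg by rewrite -(mlead_deg p0).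
  (* In the top degree the exponent of the first variable determines the monomial, so this
     coefficient of [h] is, up to sign, that of [mlead p] alone. *)
  apply: contraTneq lead_p => /polyP/(_ (mlead p 0)).
  rewrite /h big_mkcond coef_sum coef0 (bigD1_seq (mlead p)) ?msupp_uniq ?mlead_supp //=.
  rewrite deg_lead eqxx coefZ coefXn eqxx mulr1 big1 => [|m mlead_m]; last first.
    case: eqP => [mdeg_m|_]; last exact: coef0.
    rewrite coefZ coefXn; case: eqP => [m0|_]; last by rewrite mulr0.
    case/eqP: mlead_m; apply/mnmP => i; move: mdeg_m; rewrite -deg_lead !mdeg2.
    by have [->|/eqP/ord2_neq0 ->] := eqVneq i 0 => //; rewrite m0; lia.
  rewrite addr0 => /eqP; rewrite mulf_eq0 expf_eq0 oppr_eq0 oner_eq0 andbF orbF.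
  by rewrite mcoeff_eq0 mlead_supp.
have sz : size (shear l p) = deg.+1.
  apply/eqP; rewrite eqn_leq; apply/andP; split.
    apply/leq_sizeP => i lt_i; rewrite shear_coef ?(ltnW lt_i) // big_seq_cond big1 ?polyC0 // => m.
    case/andP=> /msize_mdeg_lt lt_m /eqP mE; move: lt_i; rewrite -mE.
    by case: (msize p) lt_m => // n; rewrite ltnS => le_m lt_n; have := leq_trans lt_n le_m;
      rewrite ltnn.
  rewrite ltnNge; apply/negP => /(nth_default 0); rewrite shear_coef // -hE => /eqP.
  by rewrite polyC_eq0 (negPf hl).
rewrite lead_coefE sz shear_coef // -hE ltnS deg_gt0; split=> //.
by rewrite poly_unitE size_polyC hl coefC unitfE hl.
Qed.

End GenericShear.

Lemma mup_factor (k : fieldType) (q : {poly k}) x : q != 0 ->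
  exists2 s, q = ('X - x%:P) ^+ mup x q * s & ~~ root s x.
Proof.
move=> q0; have [n [s]] := multiplicity_XsubC q x; rewrite q0 /= => sx qE.
by exists s => //; rewrite {2}qE mupMr // mup_XsubCX eqxx mulrC.
Qed.

Lemma shear_change (R S : comNzRingType) (h : {rmorphism R -> S}) l l' x y p :
  eval2 h x y (shear l p) = eval2 h (x + h (l' - l) * y) y (shear l' p).
Proof.
pose z (i : 'I_2) := if i == 0 then x - h l * y else y.
have := eval2_shear l h z p; have := eval2_shear l' h z p.
rewrite /z /= subrK => <- ->; congr (eval2 h _ _ _).
by rewrite rmorphB; ring.
Qed.

Lemma pencil0 (L : fieldType) (P : {poly {poly L}}) (h : {rmorphism L -> L}) :
  h =1 id -> pencil h P 0 = P.
Proof.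
move=> hid; rewrite /pencil !polyC0 subr0 map_poly_id // => q _ /=.
by apply: map_poly_id => c _; apply: hid.
Qed.

Lemma prod_horner_neq0 (k : fieldType) (I : eqType) (r : seq I) (P : pred I) (F : I -> {poly k})
  x i :
  (\prod_(j <- r | P j) F j).[x] != 0 -> i \in r -> P i -> (F i).[x] != 0.
Proof.
move=> prod0 ri Pi; apply: contraNneq prod0 => Fi0.
by rewrite horner_prod prodf_seq_eq0; apply/hasP; exists i; rewrite // Pi Fi0 eqxx.
Qed.

Section GoodShear.
Variables (L : fieldType) (p1 p2 : {mpoly L[2]}).
Hypothesis rootL : forall p : {poly L}, (1 < size p)%N -> exists x, root p x.
Hypothesis coprime12 : no_common_factor p1 p2.

Definition lead_good l := forall p, p \in [:: p1; p2] ->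
  lead_coef (shear l p) \is a GRing.unit /\ (1 < size (shear l p))%N.
Definition origin_good l := forall y, (shear l p1).[y%:P].[0] = 0 -> (shear l p2).[y%:P].[0] = 0
  -> y = 0.
Local Notation R l := (resultant (shear l p1) (shear l p2)).

Lemma lead_good1 l : lead_good l -> lead_coef (shear l p1) \is a GRing.unit /\ (1 < size (shear l
  p1))%N.
Proof. by apply; rewrite mem_head. Qed.

Lemma lead_good2 l : lead_good l -> lead_coef (shear l p2) \is a GRing.unit /\ (1 < size (shear l
  p2))%N.
Proof. by apply; rewrite !inE eqxx orbT. Qed.

(** [unshear] carries a common factor back to one of [p1] and [p2], hence to a unit, although its
    degree in [y'] is positive. *)
Lemma resultant_shear_neq0 l : lead_good l -> R l != 0.
Proof.
move=> /lead_good1[lead1 _]; apply/negP => /eqP/(resultant_common_factor rootL lead1).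
case=> d [a [b [d1 p1E p2E]]].
have du : unshear l d \is a GRing.unit.
  apply: (coprime12 (a := unshear l a) (b := unshear l b)).
    by rewrite -rmorphM /= -p1E; apply/esym/shearK.
  by rewrite -rmorphM /= -p2E; apply/esym/shearK.
have : shear l (unshear l d) \is a GRing.unit by apply: rmorph_unit.
by rewrite unshearK poly_unitE => /andP[/eqP d_1 _]; rewrite d_1 in d1.
Qed.

Lemma univ_resultant_at_origin l : lead_good l ->
  map_poly (meval (fun=> 0)) (univ_resultant (shear l p1) (shear l p2)) = R l.
Proof.
move=> lg; have [lead1 s1] := lead_good1 lg; have [lead2 s2] := lead_good2 lg.
apply: etrans (map_univ_resultant lead1 s1 lead2 s2 (h := idfun) (f := meval (fun=> 0)) _) _.
  by move=> c; apply: mevalC.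
have X0 i : meval (fun=> 0) ('X_i : {mpoly L[2]}) = 0 by apply: mevalXU.
by rewrite /= (X0 0) (X0 1) !pencil0.
Qed.

Lemma univ_resultant_shear_neq0 l : lead_good l -> univ_resultant (shear l p1) (shear l p2) != 0.
Proof.
move=> lg; apply: contraNneq (resultant_shear_neq0 lg) => u0.
by rewrite -univ_resultant_at_origin // u0 rmorph0.
Qed.

Lemma intersection_multiplicity_shear l : lead_good l -> origin_good l ->
  intersection_multiplicity p1 p2 0 (mup 0 (R l)).
Proof.
move=> lg og; have [lead1 s1] := lead_good1 lg; have [lead2 s2] := lead_good2 lg.
have [s RE s0] := mup_factor 0 (resultant_shear_neq0 lg).
exact: (length_at_origin rootL s1 s2 lead2 RE s0 og).
Qed.

Lemma lead_good_generic : p1 != 0 -> p2 != 0 ->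
    p1.@[(0 : 'rV[L]_2) 0] = 0 -> p2.@[(0 : 'rV[L]_2) 0] = 0 ->
  exists2 h : {poly L}, h != 0 & forall l, h.[l] != 0 -> lead_good l.
Proof.
move=> p1_0 p2_0 /(generic_shear_lead p1_0)[h1 h1_0 h1P] /(generic_shear_lead p2_0)[h2 h2_0 h2P].
exists (h1 * h2) => [|l]; first by rewrite mulf_neq0.
rewrite hornerM mulf_eq0 negb_or => /andP[/h1P g1 /h2P g2] p.
by rewrite !inE => /orP[] /eqP ->.
Qed.

(** A common zero [(0, y)] for the shear [l] reads [((la - l) y, y)] for [la], and the zeros for
    [la] form a finite list. For a listed point with nonzero ordinate, [F] is a nonconstant
    polynomial in [l] vanishing when the point falls on [x' = 0]. *)
Lemma origin_good_generic la : lead_good la ->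
  exists2 h : {poly L}, h != 0 & forall l, h.[l] != 0 -> origin_good l.
Proof.
move=> lg; have [lead1 s1] := lead_good1 lg; have [lead2 s2] := lead_good2 lg.
have [zs zsP] := common_zeros_finite s1 s2 lead2 (resultant_shear_neq0 lg).
pose F (w : L * L) : {poly L} := w.1%:P - (la%:P - 'X) * w.2%:P.
exists (\prod_(w <- zs | w.2 != 0) F w) => [|l hl y].
  rewrite prodf_seq_neq0; apply/allP => w _; apply/implyP => w2.
  apply: contraTneq w2 => /polyP/(_ 1%N).
  rewrite coefB coefC coefMC coefB coefC coefX coef0 /= !sub0r mulN1r opprK => ->.
  by rewrite eqxx.
have change_shear p : (shear l p).[y%:P].[0] = (shear la p).[y%:P].[(la - l) * y].
  apply: etrans (horner2E _ _ _) (etrans (shear_change idfun l la 0 y p) _).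
  by apply: etrans _ (esym (horner2E _ _ _)); congr (eval2 idfun _ y _); apply: add0r.
move=> /(etrans (esym (change_shear p1))) Py /(etrans (esym (change_shear p2))) Qy.
have [//|y0] := eqVneq y 0.
have := prod_horner_neq0 hl (zsP _ _ Py Qy) y0.
by rewrite /F /= !hornerE subrr eqxx.
Qed.

End GoodShear.

(** * Counting the infinitesimal solutions *)

Lemma size_pencil_gt1 (L : fieldType) (S : comNzRingType) (h : {rmorphism L -> S}) u (P : {poly
  {poly L}}) :
  lead_coef P \is a GRing.unit -> (1 < size P)%N -> (1 < size (pencil h P u))%N.
Proof. by move=> leadP P1; rewrite size_pencil. Qed.

Section Count.
Variables (L K : fieldType) (iota : {rmorphism L -> K}) (p1 p2 : {mpoly L[2]}).
Variable res : K -> L -> Prop.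
Hypothesis res_uniq : forall z a b, res z a -> res z b -> a = b.
Hypothesis res_base : forall c, res (iota c) c.
Hypothesis resB : forall z w a b, res z a -> res w b -> res (z - w) (a - b).
Hypothesis resM : forall z w a b, res z a -> res w b -> res (z * w) (a * b).
Hypothesis res_total : forall z, (exists a, res z a) \/ (z != 0 /\ res z^-1 0).
Hypothesis splitK : forall p : {poly K}, exists rs : seq K, p = lead_coef p *: \prod_(r <- rs)
  ('X - r%:P).
Hypothesis rootL : forall p : {poly L}, (1 < size p)%N -> exists x, root p x.
Hypothesis charL : [pchar L] =i pred0.
Hypothesis coprime12 : no_common_factor p1 p2.
Variable eps : 'I_2 -> K.
Hypothesis eps_small : forall i, res (eps i) 0.
Hypothesis eps_generic : forall c : {mpoly L[2]}, (map_mpoly iota c).@[eps] = 0 -> c = 0.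

Local Notation P l := (pencil iota (shear l p1) (eps 0)).
Local Notation Q l := (pencil iota (shear l p2) (eps 1)).
Local Notation univ l := (univ_resultant (shear l p1) (shear l p2)).
Local Notation R0 l := (resultant (shear l p1) (shear l p2)).
Local Notation zero_of l x y := ((P l).[y%:P].[x] = 0 /\ (Q l).[y%:P].[x] = 0).
Local Notation good l := (lead_good p1 p2 l).

Lemma rootK (p : {poly K}) : (1 < size p)%N -> exists x, root p x.
Proof.
move=> sp; have p0 : p != 0 by rewrite -size_poly_gt0 ltnW.
have [[|r rs] pE] := splitK p.
  by move: sp; rewrite pE big_nil alg_polyC size_polyC; case: eqP.
by exists r; rewrite pE rootZ ?lead_coef_eq0 // root_prod_XsubC mem_head.
Qed.

Lemma pencil_zero l x y p u : ((pencil iota (shear l p) u).[y%:P].[x] = 0) <->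
  (eval2 iota x y (shear l p) = u).
Proof.
have -> : (pencil iota (shear l p) u).[y%:P].[x] = eval2 iota x y (shear l p) - u.
  exact: etrans (horner2E _ _ _) (eval2_pencil _ _ _ _ _ _).
by split=> [/eqP|->]; rewrite ?subrr // subr_eq0 => /eqP.
Qed.

Lemma zero_change l l' x y : zero_of l x y -> zero_of l' (x + iota (l' - l) * y) y.
Proof.
by case=> /pencil_zero Px /pencil_zero Qx; split; apply/pencil_zero;
   [rewrite -[RHS]Px|rewrite -[RHS]Qx]; apply/esym/shear_change.
Qed.

Lemma zero_of_point l (z : 'I_2 -> K) :
  zero_of l (z 0 + iota l * z 1) (z 1) <->
  (map_mpoly iota p1).@[z] = eps 0 /\ (map_mpoly iota p2).@[z] = eps 1.
Proof.
have E p := eval2_shear l iota z p.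
split=> -[E1 E2]; split.
- exact: etrans (esym (E p1)) ((pencil_zero _ _ _ _ _).1 E1).
- exact: etrans (esym (E p2)) ((pencil_zero _ _ _ _ _).1 E2).
- exact: (pencil_zero _ _ _ _ _).2 (etrans (E p1) E1).
- exact: (pencil_zero _ _ _ _ _).2 (etrans (E p2) E2).
Qed.

Lemma resultant_pencil l : good l -> resultant (P l) (Q l) = map_poly (meval eps \o map_mpoly
  iota) (univ l).
Proof.
move=> lg; have [lead1 s1] := lead_good1 lg; have [lead2 s2] := lead_good2 lg.
apply/esym; apply: etrans (map_univ_resultant lead1 s1 lead2 s2 (h := iota) (f := meval eps \o
  map_mpoly iota) _) _.
  by move=> c /=; rewrite map_mpolyC mevalC.
have X0 i : (meval eps \o map_mpoly iota) ('X_i : {mpoly L[2]}) = eps i.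
  by rewrite /= map_mpolyX; apply: mevalXU.
exact: (congr2 (fun u v => resultant (pencil iota _ u) (pencil iota _ v)) (X0 0) (X0 1)).
Qed.

(** Evaluation at a generic [eps] kills no nonzero coefficient, in particular not the leading one of
    the universal resultant. *)
Lemma resultant_pencil_neq0 l : good l -> resultant (P l) (Q l) != 0.
Proof.
move=> lg; rewrite resultant_pencil //; have u0 := univ_resultant_shear_neq0 rootL coprime12 lg.
apply: contraNneq u0 => /polyP/(_ (size (univ l)).-1); rewrite coef_map coef0 -lead_coefE.
by move/eps_generic/eqP; rewrite lead_coef_eq0.
Qed.

Lemma resultant_residue l : good l -> res_poly res (resultant (P l) (Q l)) (R0 l).
Proof.
move=> lg i; rewrite resultant_pencil // -univ_resultant_at_origin // !coef_map.
exact: res_meval.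
Qed.

Lemma zeros_finite l : good l -> exists zs : seq (K * K), forall x y, zero_of l x y -> (x, y) \in
  zs.
Proof.
move=> lg; have [lead1 s1] := lead_good1 lg; have [lead2 s2] := lead_good2 lg.
have s1' := size_pencil_gt1 iota (eps 0) lead1 s1.
have s2' := size_pencil_gt1 iota (eps 1) lead2 s2.
have [zs zsP] := common_zeros_finite s1' s2' (lead_pencil_unit iota (eps 1) lead2 s2)
  (resultant_pencil_neq0 lg).
by exists zs => x y [Px Qx]; exact: (zsP x y Px Qx).
Qed.

Definition separates l := forall x y y', zero_of l x y -> zero_of l x y' -> y = y'.

(** [F] is the difference of the abscissas of two zeros as a function of [l], not identically 0 for
    distinct zeros. Its coefficients lie in [K], so the condition depends on [eps]. *)
Lemma separating_generic la : good la ->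
  exists2 h : {poly K}, h != 0 & forall l, h.[iota l] != 0 -> separates l.
Proof.
move=> /zeros_finite[zs zsP].
pose F (w : (K * K) * (K * K)) : {poly K} :=
  (w.1.1 - w.2.1)%:P + ('X - (iota la)%:P) * (w.1.2 - w.2.2)%:P.
exists (\prod_(w <- [seq (u, v) | u <- zs, v <- zs] | w.1 != w.2) F w) => [|l hl x y y' zy zy'].
  rewrite prodf_seq_neq0; apply/allP => -[[x y] [x' y']] _ /=; apply/implyP; apply: contraNneq.
  rewrite /F /= => F0; have y0 : y - y' = 0.
    have /polyP/(_ 1%N) := F0.
    by rewrite coefD coefC coefMC coefB coefC coefX coef0 /= add0r subr0 mul1r.
  move: F0; rewrite y0 polyC0 mulr0 addr0 => /eqP; rewrite polyC_eq0 => x0.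
  by rewrite xpair_eqE -(subr_eq0 x) x0 -(subr_eq0 y) y0 eqxx.
have [//|ne] := eqVneq y y'.
have := zsP _ _ (zero_change la zy); have := zsP _ _ (zero_change la zy').
set u' := (_, y'); set u := (_, y) => u'P uP.
have := prod_horner_neq0 (i := (u, u')) hl (allpairs_f (fun a b => (a, b)) uP u'P).
rewrite xpair_eqE (negPf ne) andbF => /(_ isT).
rewrite /F /= !hornerE rmorphB; set a := iota la; set b := iota l.
suff -> : x + (a - b) * y - (x + (a - b) * y') + (b - a) * (y - y') = 0 by rewrite eqxx.
by ring.
Qed.

(** An instance of [simple_root] over [K]: separation leaves a single ordinate over [xi], and the
    pair [l], [l'] provides the two directions that [jacobian_neq0] asks for. *)
Lemma mup_resultant_le1 l l' xi : good l -> good l' -> l != l' -> separates l ->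
  root (resultant (P l) (Q l)) xi -> (mup xi (resultant (P l) (Q l)) <= 1)%N.
Proof.
move=> lg l'g ll' sep Rxi; have [lead1 s1] := lead_good1 lg; have [lead2 s2] := lead_good2 lg.
have s1' := size_pencil_gt1 iota (eps 0) lead1 s1.
have s2' := size_pencil_gt1 iota (eps 1) lead2 s2.
have leadP := lead_pencil_unit iota (eps 0) lead1 s1.
have leadQ := lead_pencil_unit iota (eps 1) lead2 s2.
have [eta zeta] := resultant_root rootK leadP leadQ Rxi.
have [s RE sxi] := mup_factor xi (resultant_pencil_neq0 lg).
have Qxi := unit_lead_horner_neq0 xi leadQ.
apply: (simple_root rootK s1' s2' leadQ RE sxi Qxi _ zeta.1 zeta.2).
  by move=> y Py Qy; exact: (sep xi y eta (conj Py Qy) zeta).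
pose z (i : 'I_2) := if i == 0 then xi - iota l * eta else eta.
have xiE : xi = z 0 + iota l * z 1 by rewrite /z /= subrK.
have [E1 E2] : (map_mpoly iota p1).@[z] = eps 0 /\ (map_mpoly iota p2).@[z] = eps 1.
  by apply/(zero_of_point l); rewrite -xiE.
rewrite xiE; apply: (jacobian_neq0 charL ll' _ _ E1 E2 eps_generic).
- move=> k p + pp; rewrite !inE => /orP[] /eqP ->; [exact: lg pp|exact: l'g pp].
- by move=> k; rewrite !inE => /orP[] /eqP ->; apply: univ_resultant_shear_neq0.
Qed.

Lemma res_horner (c : {poly L}) z a : res z a -> res (map_poly iota c).[z] c.[a].
Proof.
move=> za; elim/poly_ind: c => [|c d IHc].
  by rewrite rmorph0 !horner0; apply: (res0 res_base).
rewrite rmorphD rmorphM /= map_polyC map_polyX !(hornerD, hornerM, hornerC, hornerX).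
by apply: (resD res_base resB); [apply: resM|apply: res_base].
Qed.

(** The ordinate is a root of [Q] on the line [x' = xi], whose leading coefficient is a nonzero
    constant, so it has a residue [b]. Then [(0, b)] is a common zero of the sheared polynomials,
    and [origin_good] gives [b = 0]. *)
Lemma res_ordinate l xi eta : good l -> origin_good p1 p2 l -> res xi 0 -> zero_of l xi eta ->
  res eta 0.
Proof.
move=> lg og xi0 [Pz Qz]; have [lead1 s1] := lead_good1 lg; have [lead2 s2] := lead_good2 lg.
have [b eta_b] : exists b, res eta b.
  have leadQ := lead_pencil_unit iota (eps 1) lead2 s2.
  apply: (res_integral (p := map_poly (horner_eval xi) (Q l)) (q := map_poly (horner_eval 0)
    (shear l p2)) (z := eta) res_uniq res_base resB resM res_total).
  - move=> i; rewrite !coef_map /= /horner_eval.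
    rewrite coefB coef_map coefC hornerD hornerN -[X in res _ X]subr0.
    apply: resB; first exact: res_horner.
    by case: (i == 0%N); rewrite ?hornerC ?horner0 //; apply: (res0 res_base).
  - rewrite !size_map_poly_id0 ?unit_horner_neq0 //; exact: size_pencil.
  - exact: unit_lead_horner_neq0 lead2.
  - by rewrite rootE -horner2_swap Qz.
suff b0 : b = 0 by rewrite -b0.
move: Pz Qz => /pencil_zero Pz /pencil_zero Qz.
apply: og; apply: etrans (horner2E _ _ _) _.
  apply: res_uniq (res_horner2 res_base resB resM (shear l p1) xi0 eta_b) _.
  by rewrite Pz.
apply: res_uniq (res_horner2 res_base resB resM (shear l p2) xi0 eta_b) _.
by rewrite Qz.
Qed.

(** Abscissas match solutions with infinitesimal roots of the resultant: [res_ordinate] makes the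
    point over such a root infinitesimal, [separates] makes it unique, and simplicity of the roots
    turns a count with multiplicity into a count of points. *)
Lemma count_solutions l l' : good l -> good l' -> l != l' -> origin_good p1 p2 l -> separates l ->
  exists s : seq 'rV[K]_2, [/\ uniq s, size s = mup 0 (R0 l)
    & forall z, z \in s <-> [/\ forall j, res (z 0 j) 0,
        (map_mpoly iota p1).@[z 0] = eps 0 & (map_mpoly iota p2).@[z 0] = eps 1]].
Proof.
move=> lg l'g ll' og sep; have [lead1 s1] := lead_good1 lg; have [lead2 s2] := lead_good2 lg.
have s1' := size_pencil_gt1 iota (eps 0) lead1 s1.
have s2' := size_pencil_gt1 iota (eps 1) lead2 s2.
have leadP := lead_pencil_unit iota (eps 0) lead1 s1.
have leadQ := lead_pencil_unit iota (eps 1) lead2 s2.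
set Rl := resultant (P l) (Q l).
have Rl0 : Rl != 0 by apply: resultant_pencil_neq0.
have [rs RlE] := splitK Rl.
have size_rs := infinitesimal_roots res_uniq res_base resB resM res_total RlE
  (resultant_shear_neq0 rootL coprime12 lg) (resultant_residue lg).
set rsM := [seq r <- rs | _] in size_rs.
have rsME xi : xi \in rsM = `[< res xi 0 >] && root Rl xi.
  by rewrite mem_filter RlE rootZ ?lead_coef_eq0 // root_prod_XsubC.
have uniq_rsM : uniq rsM.
  apply: count_mem_uniq => xi.
  have countE : count_mem xi rs = mup xi Rl.
    by rewrite RlE -mul_polyC mupMr ?mu_prod_XsubC // rootC lead_coef_eq0.
  have [xM|/count_memPn -> //] := boolP (xi \in rsM).
  apply/eqP; rewrite eqn_leq; apply/andP; split; last by rewrite -has_count has_pred1.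
  apply: (leq_trans (leq_count_subseq _ (filter_subseq _ rs))); rewrite countE.
  move: xM; rewrite rsME => /andP[_ Rxi].
  exact: mup_resultant_le1 lg l'g ll' sep Rxi.
have /choice[eta etaP] xi : exists y, root Rl xi -> zero_of l xi y.
  have [/(resultant_root rootK leadP leadQ)[y yP]|nr] := boolP (root Rl xi); first by exists y.
  by exists 0.
pose pt xi : 'rV[K]_2 := \row_i if i == 0 then xi - iota l * eta xi else eta xi.
have ptE xi : pt xi 0 0 + iota l * pt xi 0 1 = xi by rewrite !mxE /= subrK.
exists [seq pt xi | xi <- rsM]; split.
- by rewrite map_inj_uniq // => xi xi' E; rewrite -(ptE xi) E ptE.
- by rewrite size_map.
move=> z; split=> [/mapP[xi]|[z_small E1 E2]].
  rewrite rsME => /andP[/asboolP xi0 Rxi] ->.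
  have zxi := etaP _ Rxi; have eta0 := res_ordinate lg og xi0 zxi.
  have [E1 E2] : (map_mpoly iota p1).@[pt xi 0] = eps 0 /\ (map_mpoly iota p2).@[pt xi 0] = eps 1.
    by apply/(zero_of_point l); rewrite ptE mxE.
  split=> // j; rewrite mxE; case: eqP => // _.
  by have := resB xi0 (resM (res_base l) eta0); rewrite mulr0 subr0.
pose xi := z 0 0 + iota l * z 0 1.
have zxi : zero_of l xi (z 0 1) by apply/zero_of_point.
have xi0 : res xi 0.
  have := resD res_base resB (z_small 0) (resM (res_base l) (z_small 1)).
  by rewrite mulr0 addr0.
have Rxi : root Rl xi by apply: root_resultant zxi.1 zxi.2.
apply/mapP; exists xi; first by rewrite rsME asboolT.
have eta_z : eta xi = z 0 1 by apply: sep (etaP _ Rxi) zxi.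
apply/rowP=> i; rewrite mxE eta_z /xi addrK.
by have [->|/eqP/ord2_neq0 ->] := eqVneq i 0.
Qed.

End Count.

(** * Independence of the shear, and the conclusion *)

Lemma has_length_uniq (R : pzRingType) (M : lmodType R) m m' :
  has_length M m -> has_length M m' -> m = m'.
Proof.
move=> [[N NP] Nmax] [[N' N'P] N'max]; apply/eqP; rewrite eqn_leq.
by rewrite (N'max _ _ NP) (Nmax _ _ N'P).
Qed.

Lemma intersection_multiplicity_uniq (L : fieldType) (p1 p2 : {mpoly L[2]}) a m m' :
  intersection_multiplicity p1 p2 a m -> intersection_multiplicity p1 p2 a m' -> m = m'.
Proof. exact: has_length_uniq. Qed.

Theorem theorem6p10 (L : closedFieldType)
    (closure : forall k : closedFieldType, laurent_closure k)
    (Komega : tower_union closure L) (p1 p2 : {mpoly L[2]})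
    (charL : [pchar L] =i pred0)
    (irr1 : irreducible p1) (irr2 : irreducible p2)
    (p1_0 : p1.@[(0 : 'rV[L]_2) 0] = 0) (p2_0 : p2.@[(0 : 'rV[L]_2) 0] = 0)
    (coprime12 : no_common_factor p1 p2) :
  exists m : nat, intersection_multiplicity p1 p2 0 m /\
                  zariski_multiplicity Komega p1 p2 m.
Proof.
have [p1n0 _ _] := irr1; have [p2n0 _ _] := irr2.
have rootL (p : {poly L}) : (1 < size p)%N -> exists x, root p x.
  by move=> sp; apply/closed_rootP; rewrite neq_ltn sp orbT.
have [h h0 hP] := lead_good_generic p1n0 p2n0 p1_0 p2_0.
(* [la] is auxiliary: the finitely many common zeros are listed in its coordinates, from which the
   remaining conditions on a shear are expressed. *)
have [la hla] := nonroot_exists idfun charL h0.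
have {}hla := hP _ hla.
have [h' h'0 h'P] := origin_good_generic rootL coprime12 hla.
(* [l1] is chosen before [eps] and fixes [m]. *)
have [l1 hl1] := nonroot_exists idfun charL (mulf_neq0 h0 h'0).
have [hl1' h'l1] : h.[l1] != 0 /\ h'.[l1] != 0.
  by apply/andP; rewrite -negb_or -mulf_eq0 -hornerM.
have lg1 := hP _ hl1'; have og1 := h'P _ h'l1.
have length1 := intersection_multiplicity_shear rootL coprime12 lg1 og1.
exists (mup 0 (resultant (shear l1 p1) (shear l1 p2)));
  split=> // eps eps_gen /inf_nbhd_residue eps_res.
have eps_small i : union_residue (K := Komega) (eps 0 i) 0 by have := eps_res i; rewrite mxE.
have [h3 h3_0 h3P] := separating_generic rootL coprime12 eps_gen hla.
have h4_0 : map_poly (base_incl Komega) (h * h') * h3 != 0.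
  by rewrite mulf_neq0 // map_poly_eq0 mulf_neq0.
(* [l2] must moreover separate the solutions over the given [eps]. *)
have [l2] := nonroot_exists (base_incl Komega) charL h4_0.
rewrite hornerM mulf_eq0 horner_map fmorph_eq0 hornerM mulf_eq0 !negb_or.
case/andP=> /andP[hl2 h'l2] h3l2.
have lg2 := hP _ hl2; have og2 := h'P _ h'l2; have sep2 := h3P _ h3l2.
(* [l3] only supplies the second direction for the Jacobian: an admissible leading coefficient and
   [l3 != l2] suffice. *)
have [l3] := nonroot_exists idfun charL (mulf_neq0 h0 (negbT (polyXsubC_eq0 l2))).
rewrite hornerM mulf_eq0 negb_or hornerXsubC subr_eq0 => /andP[hl3]; rewrite eq_sym => l23.
have lg3 := hP _ hl3.
have length2 := intersection_multiplicity_shear rootL coprime12 lg2 og2.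
have [s [uniq_s size_s sP]] := count_solutions (@union_residue_uniq _ _ Komega)
  (@union_residue_base _ _ Komega)
  (@union_residueB _ _ Komega) (@union_residueM _ _ Komega) (@union_residue_total _ _ Komega)
    (@tower_union_splits _ _ Komega)
  rootL charL coprime12 eps_small eps_gen lg2 lg3 l23 og2 sep2.
exists s; split; first exact: uniq_s.
  (* The count was made with [l2]; both shears compute the same length. *)
  by rewrite size_s; apply: intersection_multiplicity_uniq length2 length1.
move=> z; split=> [/sP[z_small E1 E2]|[z_small E1 E2]].
  split; [|exact: E1|exact: E2].
  by apply/inf_nbhd_residue => j; rewrite mxE; apply: z_small.
apply/sP; split; [|exact: E1|exact: E2] => j.
by move/inf_nbhd_residue: z_small => /(_ j); rewrite mxE.
Qed.
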